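(* Consider the single-server queueing system described in the context, with Poisson arrivals of rate $\lambda>0$ and service time distribution function $G$, $G(+0)=0$. Let $q=\mathbf{P}(\tau<\eta)$, where $\tau$ and $\eta$ are independent, $\tau$ is exponential with parameter $\lambda$ and $\mathbf{P}(\eta<t)=G(t)$. Let $\alpha_0$ and $\alpha_1$ be the sojourn times (total times spent) of the system in states $0$ and $1$, respectively, on the first regeneration cycle $[S_0,S_1)$. Then $$\mathbf{P}(\alpha_0>t)=(1-q)e^{-\lambda qt}\ \text{ for } t>0,\qquad \mathbf{P}(\alpha_0=0)=q,$$ $$\mathbf{P}(\alpha_1>t)=e^{-\lambda t}\ \text{ for } t>0.$$
   Context: Customers arrive to a single server at random times whose successive interarrival times are i.i.d. exponential with parameter $\lambda$ (a Poisson flow); the first customer arrives at time $t_1$, which is exponential with parameter $\lambda$. An arriving customer starts service at once if the server is free, and otherwise joins a queue of unlimited size. Service times are i.i.d. with distribution function $G(t)=\mathbf{P}(\eta<t)$ and are independent of the arrivals. After completing a service the server takes the next customer from the queue if the queue is nonempty, and otherwise waits for a new customer. $\xi(t)$ is the number of customers in the system at time $t$, $\xi(0)=0$ a.s.; the system is in state $k$ at time $t$ if $\xi(t)=k$. $S_0=t_1$ is the arrival time of the first customer, and $S_1$ is the first moment of transition of $\xi$ from state $2$ to state $1$. *)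

(* Defs.v *)
From HB Require Import structures.
From mathcomp Require Import all_boot all_order all_algebra.
From mathcomp Require Import all_classical all_reals all_analysis.
Import Order.TTheory GRing.Theory Num.Theory.
Import numFieldNormedType.Exports.

Set Implicit Arguments.
Unset Strict Implicit.
Unset Printing Implicit Defensive.

Local Open Scope classical_set_scope.
Local Open Scope ring_scope.

Section probability_notions.
Context d (T : measurableType d) (R : realType) (P : probability T R).

Definition mutually_independent (I : eqType) (X : I -> T -> R) : Prop :=
  forall (s : seq I) (B : I -> set R),
    uniq s -> (forall i, measurable (B i)) ->
    P (\bigcap_(i in [set` s]) (X i @^-1` B i)) =
    (\prod_(i <- s) P (X i @^-1` B i))%E.

Definition exponentially_distributed (lambda : R) (X : {RV P >-> R}) : Prop :=
  forall B : set R, measurable B ->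
    distribution P X B = exponential_prob lambda B.

(* [A] is an event of the [P]-completion, of probability [p].  The sojourn
   times below are defined for every sample point, including those of the null
   set where arrivals accumulate or interarrival times are negative; their
   level sets are therefore only required to be measurable up to a null set.
   [P A] itself would be unspecified for a nonmeasurable [A]. *)
Definition has_probability (A : set T) (p : \bar R) : Prop :=
  exists B : set T,
    [/\ measurable B, {ae P, forall w, A w <-> B w} & P B = p].

Lemma has_probability_measurable (A : set T) (p : \bar R) :
  measurable A -> has_probability A p <-> P A = p.
Proof.
move=> mA; split => [[B [mB AB <-]]|PA].
  have /negligibleP AB0 : P.-negligible ((A `\` B) `|` (B `\` A)).
    apply: negligibleS AB => w /= [[Aw nBw]|[Bw nAw]] [AB BA].
      exact/nBw/AB.
    exact/nAw/BA.
  have mAB : measurable (A `\` B) by exact: measurableD.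
  have mBA : measurable (B `\` A) by exact: measurableD.
  have P0 : P (A `\` B `|` B `\` A) = 0%E by apply: AB0; exact: measurableU.
  have PAB : P (A `\` B) = 0%E.
    by apply: (subset_measure0 _ _ _ P0) => //; exact: measurableU.
  have PBA : P (B `\` A) = 0%E.
    by apply: (subset_measure0 _ _ _ P0) => //; exact: measurableU.
  have -> : P A = (P (A `\` B) + P (A `&` B))%E by exact: measureDI.
  have -> : P B = (P (B `\` A) + P (B `&` A))%E by exact: measureDI.
  by rewrite PAB PBA setIC.
by exists A; split => //; exact: aeW.
Qed.

End probability_notions.

(* One sample path of the queue.  Customers are numbered from 0, [x n] is the
   time between the arrivals of customers [n - 1] and [n] ([x 0] is the arrival
   time of the first customer), and [y n] is the [n]-th service time. *)
Section sample_path.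
Context {R : realType} (x y : nat -> R).

Definition arrival (n : nat) : R := \sum_(i < n.+1) x i.

(* Service starts on arrival if the server is free, and otherwise as soon as
   the preceding customer leaves. *)
Fixpoint departure (n : nat) : R :=
  match n with
  | 0 => arrival 0
  | m.+1 => Num.max (arrival m.+1) (departure m)
  end + y n.

Definition xi (t : R) : \bar R :=
  counting [set n | arrival n <= t /\ t < departure n].

Definition S0 : R := arrival 0.

Definition transition21 (t : R) : Prop :=
  xi t = 1%:E /\ \forall s \near t^'-, xi s = 2%:E.

(* [+oo] if the path never jumps from 2 to 1; the cycle is then [[S0, +oo)]. *)
Definition S1 : \bar R := ereal_inf [set t%:E | t in transition21].

Definition sojourn (k : nat) : \bar R :=
  lebesgue_measure [set t : R | [/\ S0 <= t, (t%:E < S1)%E & xi t = k%:R%:E]].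

End sample_path.

(* Main.v *)
Require Import Defs.
From HB Require Import structures.
From mathcomp Require Import all_boot all_order all_algebra.
From mathcomp Require Import all_classical all_reals all_analysis.
From mathcomp Require Import measurable_realfun.
From mathcomp Require Import ring lra.
Import Order.TTheory GRing.Theory Num.Theory.
Import numFieldNormedType.Exports.

(** Let [N] be the first customer whose service outlasts the interarrival time
that follows, [x N.+1 < y N]. The customers before [N] leave before the next one
arrives, so until customer [N.+1] arrives the system alternates between state 1,
for the times [y i], and state 0, for the times [x i.+1 - y i]. From that arrival
on at least two customers are present until [S1]. Hence the sojourn times in
states 0 and 1 are the sum of [x i.+1 - y i] over [i < N], and the sum of [y i]
over [i < N] plus [x N.+1] ([sojourn_idle], [sojourn_alone]), on almost every
path ([ae_cycle_ends]).

By the lack of memory of the exponential law, a customer with service time [y]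
is not overtaken with probability [expR (- (lambda * y))], of average [1 - q]
([laplace_race]), and the idle period that follows is again exponential with
parameter [lambda]. So, given that nobody has been overtaken and that [r <= t] is
the time spent so far in the state considered, the conditional probability of
ending above [t] should be [(1 - q) * expR (- (lambda * q * (t - r)))] for
state 0 and [expR (- (lambda * (t - r)))] for state 1. For the latter, the clock
of the next arrival runs exactly while the system is in state 1.

These formulas are verified rather than derived. Their expectation [M n] over the
paths on which the first [n] customers were alone and [r <= t] satisfies
[M n = M n.+1 + P (D n)], where [D n] is the event that level [t] is passed with
customer [n] ([idle_step], [busy_step]). Moreover [M n] is at most
[(1 - q) ^+ n] ([probability_alone]), which vanishes because [G(+0) = 0] makes
[q] positive ([race_gt0]). Therefore the probabilities of the events [D n] add up
to [M 0] ([exit_probability]), which is the value of the formula at [r = 0]. The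
atom of the first law at 0 is the complement of its tail at level 0.

Each step of the recursion integrates out one service and one interarrival
time, independent of the past ([ge0_integral_past]). *)

Set Implicit Arguments.
Unset Strict Implicit.
Unset Printing Implicit Defensive.

Local Open Scope classical_set_scope.
Local Open Scope ring_scope.

(** * Integrating out a variable independent of the past *)

Section independent_pair.
Local Open Scope ereal_scope.
Context d d1 d2 (T : measurableType d) (T1 : measurableType d1)
  (T2 : measurableType d2) (R : realType) (P : probability T R).

Lemma ge0_integral_independent (W : {mfun T >-> T1}) (Z : {mfun T >-> T2})
    (nu : probability T2 R) (f : T1 * T2 -> \bar R) :
  (forall A B, measurable A -> measurable B ->
     P (W @^-1` A `&` Z @^-1` B) = P (W @^-1` A) * nu B) ->
  measurable_fun [set: T1 * T2] f -> (forall x, 0 <= f x) ->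
  \int[P]_w f (W w, Z w) = \int[P]_w \int[nu]_z f (W w, z).
Proof.
move=> ind mf f0.
have mWZ : measurable_fun setT (fun w => (W w, Z w)).
  by apply/measurable_fun_pairP; split; exact: measurable_funP.
pose WZ : {mfun T >-> (T1 * T2)%type} :=
  HB.pack (fun w => (W w, Z w)) (isMeasurableFun.Build _ _ _ _ _ mWZ).
transitivity (\int[distribution P WZ]_p f p).
  by rewrite ge0_integral_pushforward.
transitivity (\int[distribution P W \x nu]_p f p).
  apply: eq_measure_integral => A mA _; apply/esym.
  apply: (@product_measure_unique _ _ _ _ _ (distribution P W) nu
    (distribution P WZ)) => //=.
rewrite fubini_tonelli1// ge0_integral_distribution//=.
- exact: measurable_fun_fubini_tonelli_F.
- by move=> x; exact: integral_ge0.
Qed.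

End independent_pair.

Section past.
Context d (T : measurableType d) (R : realType) (P : probability T R).
Context (I : eqType) (Z : I -> {RV P >-> R}).

Definition cylinders (s : seq I) : set (set T) :=
  [set \bigcap_(i in [set` s]) (Z i @^-1` B i) |
    B in [set B : I -> set R | forall i, measurable (B i)]].

(** The sample space itself, with the smaller sigma-algebra generated by the
variables of index in [s]: a function that depends only on these variables is
one that is measurable on this space, so no tuple of their values is needed. *)
Definition past (s : seq I) := g_sigma_algebraType (cylinders s).

Lemma cylindersI s : setI_closed (cylinders s).
Proof.
move=> _ _ [B mB <-] [C mC <-]; exists (fun i => B i `&` C i).
  by move=> i; exact: measurableI.
rewrite -bigcapI; apply: eq_bigcapr => i _.
by rewrite preimage_setI.
Qed.

Lemma cylindersT s : cylinders s setT.
Proof.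
by exists (fun=> setT) => //; apply/seteqP; split.
Qed.

Lemma measurable_past s (A : set (past s)) :
  measurable A -> measurable (A : set T).
Proof.
apply: smallest_sub; first exact: sigma_algebra_measurable.
move=> _ [B mB <-]; apply: fin_bigcap_measurable; first exact: finite_seq.
by move=> i _; rewrite -[_ @^-1` _]setTI; exact: measurable_funP.
Qed.

Lemma measurable_past_coord s i : i \in s ->
  measurable_fun setT (Z i : past s -> R).
Proof.
move=> si _ B mB; rewrite setTI; apply: sub_sigma_algebra.
exists (fun j => if j == i then B else setT) => [j /=|].
  by case: ifP => // _; exact: measurableT.
apply/seteqP; split=> [w /(_ i si)/=|w Bw j sj /=]; first by rewrite eqxx.
by case: eqP => // ->.
Qed.

Hypothesis indep : mutually_independent P (fun i => Z i : T -> R).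

(** Mutual independence is the claim on [cylinders s], which are stable under
intersection; two finite measures that agree on them agree on the generated
sigma-algebra. *)
Lemma past_independent k s (A : set T) (B : set R) : uniq (k :: s) ->
  (cylinders s).-sigma.-measurable A -> measurable B ->
  P (A `&` Z k @^-1` B) = (P A * P (Z k @^-1` B))%E.
Proof.
move=> uks mA mB.
have mkB : measurable (Z k @^-1` B).
  by rewrite -[_ @^-1` _]setTI; exact: measurable_funP.
have PkB : P (Z k @^-1` B) = (fine (P (Z k @^-1` B)))%:E.
  by rewrite fineK// fin_num_measure.
have PkB0 : 0 <= fine (P (Z k @^-1` B)) by exact/fine_ge0.
rewrite muleC PkB -[LHS]/(mrestr P mkB A).
rewrite -[RHS]/(mscale (NngNum PkB0) P A).
apply: (@g_sigma_algebra_measure_unique _ _ _ (cylinders s) _ (fun=> setT)) => //.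
- by move=> C Cs; apply: (@measurable_past s); exact: sub_sigma_algebra.
- by move=> _; exact: cylindersT.
- by rewrite bigcup_const.
- exact: cylindersI.
- move=> _ [C mC <-] /=; rewrite /mrestr /mscale/= -PkB.
  (* adding the condition on [Z k] to a cylinder gives a cylinder on [k :: s] *)
  pose C' i := if i == k then B else C i.
  have mC' i : measurable (C' i) by rewrite /C'; case: ifP.
  have C'C : {in s, C' =1 C}.
    move=> i si; rewrite /C'; case: eqP => // ik.
    by move: uks; rewrite /= -ik si.
  transitivity (P (\bigcap_(i in [set` k :: s]) (Z i @^-1` C' i))).
    congr (P _); apply/seteqP; split=> w.
      move=> [sw kw] i /=; rewrite inE => /orP[/eqP ->|si].
        by rewrite /C' eqxx.
      by rewrite C'C//; exact: sw.
    move=> sw; split=> [i si|].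
      by rewrite /preimage/= -C'C//; apply: sw; rewrite /= inE si orbT.
    by have := sw k; rewrite /preimage/= /C' eqxx; apply; rewrite inE eqxx.
  have us : uniq s by case/andP: uks.
  rewrite [LHS](indep uks mC') [X in (_ * X)%E](indep us mC).
  rewrite big_cons/= {1}/C' eqxx; congr (_ * _)%E.
  by rewrite !big_seq; apply: eq_bigr => i si; rewrite C'C.
- by move=> _; rewrite /= /mrestr/= setTI ltey_eq fin_num_measure.
Qed.

(** Conditioning on the past amounts to Tonelli's theorem: by independence the
pair made of the past and of [Z k] has a product law, for the past seen as the
identity map onto [past s]. *)
Lemma ge0_integral_past k s (nu : probability R R)
    (f : past s * R -> \bar R) : uniq (k :: s) ->
  (forall B, measurable B -> P (Z k @^-1` B) = nu B) ->
  measurable_fun [set: past s * R] f -> (forall x, 0 <= f x)%E ->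
  (\int[P]_w f (w, Z k w) = \int[P]_w \int[nu]_z f (w, z))%E.
Proof.
move=> uks Znu mf f0.
have mid : measurable_fun setT (id : T -> past s).
  by move=> _ A mA; rewrite setTI; exact: (@measurable_past s).
pose W : {mfun T >-> past s} :=
  HB.pack (id : T -> past s) (isMeasurableFun.Build _ _ _ _ _ mid).
apply: (@ge0_integral_independent _ _ _ _ _ _ _ P W (Z k)) => // A B mA mB.
by rewrite -Znu// -(past_independent uks).
Qed.

End past.

(** * The first cycle of a path *)

Section path.
Context (R : realType) (x y : nat -> R).

(** Each of the first [n] customers leaves before the next one arrives, so
that customer [n] finds the server free. *)
Definition alone (n : nat) : Prop := forall i, (i < n)%N -> y i <= x i.+1.

Definition idle (n : nat) : R := \sum_(i < n) (x i.+1 - y i).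

Definition busy (n : nat) : R := \sum_(i < n) y i.

Lemma idleS n : idle n.+1 = idle n + (x n.+1 - y n).
Proof. by rewrite /idle big_ord_recr. Qed.

Lemma busyS n : busy n.+1 = busy n + y n.
Proof. by rewrite /busy big_ord_recr. Qed.

Lemma aloneS n : alone n.+1 <-> alone n /\ y n <= x n.+1.
Proof.
split=> [An|[An yx] i]; first by split=> [i /ltnW|]; apply: An.
by rewrite ltnS leq_eqVlt => /orP[/eqP ->//|]; exact: An.
Qed.

Lemma aloneW m n : (m <= n)%N -> alone n -> alone m.
Proof. by move=> mn An i im; apply: An; exact: leq_trans mn. Qed.

Lemma not_alone : ~ (forall n, alone n) ->
  exists N, alone N /\ x N.+1 < y N.
Proof.
move=> nA; have [k nAk] : exists k, `[< ~ alone k >].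
  by apply: contra_notP nA => nA k; apply: contra_notP nA => ?; exists k; exact/asboolP.
have [[|n] /asboolP nAn nmin] := ex_minnP (ex_intro (fun n => `[< ~ alone n >]) k nAk).
  by exfalso; apply: nAn.
have An : alone n.
  by apply: contrapT => /asboolP/nmin; rewrite ltnn.
by exists n; split=> //; rewrite ltNge; apply/negP => yx; apply/nAn/aloneS.
Qed.

Hypotheses (x_gt0 : forall n, 0 < x n) (y_gt0 : forall n, 0 < y n).

Section end_of_cycle.
Variable N : nat.
Hypotheses (aloneN : alone N) (overtake : x N.+1 < y N).

Lemma alone_leq n : alone n -> (n <= N)%N.
Proof. by move=> An; rewrite leqNgt; apply/negP => /An; rewrite leNgt overtake. Qed.

Lemma idle_le m n : (m <= n <= N)%N -> idle m <= idle n.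
Proof.
move=> /andP[/subnK <-]; elim: (n - m)%N => [//|k IH] kN.
rewrite addSn idleS (le_trans (IH (ltnW kN)))// lerDl subr_ge0.
exact: aloneN.
Qed.

Lemma busy_le m n : (m <= n)%N -> busy m <= busy n.
Proof.
move=> /subnK <-; elim: (n - m)%N => [//|k IH].
by rewrite addSn busyS (le_trans IH)// lerDl ltW.
Qed.

(** The next two lemmas locate the step at which the accumulated time passes
the level [t]; the steps are disjoint events, whose probabilities can be
added. *)
Lemma idle_crossing (t : R) : 0 <= t ->
  t < idle N <-> exists n, alone n.+1 /\ idle n <= t < idle n.+1.
Proof.
move=> t0; split=> [tN|[n [/alone_leq nN /andP[_ tn]]]]; last first.
  by rewrite (lt_le_trans tn)// idle_le// nN leqnn.
have [[|n] tn nmin] := ex_minnP (ex_intro (fun n => t < idle n) N tN).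
  by move: tn; rewrite /idle big_ord0 ltNge t0.
exists n; split; first by apply: aloneW aloneN; exact: nmin.
rewrite tn andbT leNgt.
by apply/negP => /nmin; rewrite ltnn.
Qed.

Lemma busy_crossing (t : R) : 0 <= t ->
  t < busy N + x N.+1 <->
  exists n, [/\ alone n, busy n <= t < busy n.+1 & t < busy n + x n.+1].
Proof.
move=> t0; split=> [tN|[n [/alone_leq nN /andP[_ tn] tx]]]; last first.
  move: nN; rewrite leq_eqVlt => /orP[/eqP<-//|nN].
  by rewrite (lt_le_trans tn)// (le_trans (busy_le nN))// lerDl ltW.
have tNS : t < busy N.+1 by rewrite (lt_trans tN)// busyS ltrD2l.
have [[|n] tn nmin] := ex_minnP (ex_intro (fun n => t < busy n) _ tNS).
  by move: tn; rewrite /busy big_ord0 ltNge t0.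
have nN : (n <= N)%N by rewrite -ltnS; exact: nmin.
exists n; split; first exact: (aloneW nN).
  by rewrite tn andbT leNgt; apply/negP => /nmin; rewrite ltnn.
move: nN; rewrite leq_eqVlt => /orP[/eqP->//|nN].
by rewrite (lt_le_trans tn)// busyS lerD2l aloneN.
Qed.

End end_of_cycle.

Lemma arrivalS n : arrival x n.+1 = arrival x n + x n.+1.
Proof. by rewrite /arrival big_ord_recr. Qed.

Lemma arrival_le : {mono arrival x : m n / (m <= n)%N >-> m <= n}.
Proof.
by apply: le_mono; apply: homo_ltn lt_trans _ => n; rewrite arrivalS ltrDl.
Qed.

Lemma arrival_lt : {mono arrival x : m n / (m < n)%N >-> m < n}.
Proof. exact: leW_mono arrival_le. Qed.

Lemma arrival_lt_departure n : arrival x n < departure x y n.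
Proof.
case: n => [|n] /=; first by rewrite ltrDl.
by rewrite ltr_pwDr// le_max lexx.
Qed.

Lemma departure_le : {mono departure x y : m n / (m <= n)%N >-> m <= n}.
Proof.
apply: le_mono; apply: homo_ltn lt_trans _ => n /=.
by rewrite ltr_pwDr// le_max lexx orbT.
Qed.

Lemma departure_lt : {mono departure x y : m n / (m < n)%N >-> m < n}.
Proof. exact: leW_mono departure_le. Qed.

Definition present (t : R) : set nat :=
  [set n | arrival x n <= t /\ t < departure x y n].

Lemma xi0 t : present t = set0 -> xi x y t = 0%E.
Proof.
rewrite /xi -/(present t) => ->.
by rewrite /counting asboolT// fset_set0 finmap.cardfs0.
Qed.

Lemma xi1 t n : present t = [set n] -> xi x y t = 1%:E.
Proof.
rewrite /xi -/(present t) => ->.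
by rewrite /counting asboolT// fset_set1 finmap.cardfs1.
Qed.

Lemma xi2 t m n : m != n -> present t = [set m; n] -> xi x y t = 2%:E.
Proof.
move=> mn; rewrite /xi -/(present t) => ->.
rewrite /counting asboolT; last by rewrite finite_setU; split; exact: finite_set1.
by rewrite fset_setU// !fset_set1 finmap.cardfs2 mn.
Qed.

Lemma xi_le1 t m n (k : nat) : (k <= 1)%N -> xi x y t = k%:R%:E ->
  present t m -> present t n -> m = n.
Proof.
rewrite /xi -/(present t) => k1; rewrite /counting.
case: ifPn => // /asboolP fin [] /eqP; rewrite eqr_nat => /eqP card pm pn.
apply: contrapT => /eqP mn; move: k1; rewrite -card leqNgt => /negP; apply.
suff /finmap.fsubset_leq_card : finmap.fsubset
    (finmap.fsetU (finmap.fset1 m) (finmap.fset1 n)) (fset_set (present t)).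
  by rewrite finmap.cardfs2 mn.
apply/finmap.fsubsetP => i.
by rewrite finmap.in_fset2 in_fset_set// => /orP[] /eqP ->; exact/mem_set.
Qed.

(** In this section [N] is the customer who is overtaken: customer [N.+1]
arrives while [N] is being served alone, which is the first time that the system
enters state 2. *)
Section first_cycle.
Hypothesis arrival_unbounded : forall b, exists n, b < arrival x n.
Variable N : nat.
Hypotheses (aloneN : alone N) (overtake : x N.+1 < y N).

Lemma departure_alone n : (n <= N)%N -> departure x y n = arrival x n + y n.
Proof.
elim: n => [//|n IH] nN /=; rewrite max_l//.
by rewrite IH 1?ltnW// arrivalS lerD2l aloneN.
Qed.

Lemma departure_le_arrival n : (n < N)%N -> departure x y n <= arrival x n.+1.
Proof. by move=> nN; rewrite departure_alone ?(ltnW nN)// arrivalS lerD2l aloneN. Qed.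

Lemma arrival_lt_departureN : arrival x N.+1 < departure x y N.
Proof. by rewrite departure_alone// arrivalS ltrD2l. Qed.

Lemma locate t n : S0 x <= t -> t < arrival x n.+1 ->
  exists2 m, (m <= n)%N & arrival x m <= t < arrival x m.+1.
Proof.
move=> t0 tn.
have [[|m] tm mmin] := ex_minnP (ex_intro (fun m => t < arrival x m) _ tn).
  by move: t0; rewrite /S0 leNgt tm.
exists m; first by rewrite -ltnS mmin.
by rewrite tm andbT leNgt; apply/negP => /mmin; rewrite ltnn.
Qed.

Lemma present_alone t n : (n <= N)%N -> arrival x n <= t < arrival x n.+1 ->
  present t = if t < departure x y n then [set n] else set0.
Proof.
move=> nN /andP[nt tn]; apply/seteqP; split=> m; last first.
  by case: ifPn => //= td ->.
move=> [mt tm]; have mn : m = n.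
  apply/eqP; rewrite eqn_leq -ltnS -arrival_lt (le_lt_trans mt tn)/= leqNgt.
  apply/negP => mn; move: tm; apply/negP; rewrite -leNgt (le_trans _ nt)//.
  rewrite (le_trans (departure_le_arrival _)) ?arrival_le//.
  exact: leq_trans nN.
by move: tm; rewrite mn => ->.
Qed.

Lemma xi_alone t n : (n <= N)%N -> arrival x n <= t < arrival x n.+1 ->
  xi x y t = (t < departure x y n)%R%:R%:E.
Proof.
move=> nN tn; have := present_alone nN tn.
by case: ifPn => _; [exact: xi1|exact: xi0].
Qed.

Lemma xi_before t : t < arrival x N.+1 -> xi x y t <> 2%:E.
Proof.
move=> tN; have [tS|tS] := ltP t (S0 x).
  rewrite xi0; first by case=> /eqP; rewrite eq_sym pnatr_eq0.
  apply/seteqP; split=> // m [mt _].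
  have : S0 x <= t by rewrite (le_trans _ mt)// arrival_le.
  by rewrite leNgt tS.
have [n nN tn] := locate tS tN; rewrite (xi_alone nN tn).
by case=> /eqP; rewrite eqr_nat; case: (_ < _).
Qed.

(** Before customer [N.+1] arrives the system is only ever in states 0 and 1,
hence cannot jump down from state 2. *)
Lemma S1_ge : ((arrival x N.+1)%:E <= S1 x y)%E.
Proof.
apply: le_ereal_inf_tmp => _ [t [_ t2] <-]; rewrite lee_fin leNgt; apply/negP => tN.
near (t^'-) => s.
have : xi x y s = 2%:E by near: s.
apply: xi_before; rewrite (lt_trans _ tN)//; near: s; exact: nbhs_left_lt.
Unshelve. all: by end_near. Qed.

(** Once customer [N.+1] has arrived, states 0 and 1 are only met after [S1].
Being in one of them at time [t] forces some customer [m] with [N <= m] to have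
left by time [t] and before customer [m.+2] arrives. For the first such customer
[j], the departure of [j] leaves customer [j.+1] alone, whereas just before it
the customers present are [j] and [j.+1]. *)
Lemma S1_le t (k : nat) : (k <= 1)%N -> arrival x N.+1 <= t ->
  xi x y t = k%:R%:E -> (S1 x y <= t%:E)%E.
Proof.
move=> k1 Nt xik.
have [b tb] := arrival_unbounded t.
have ex : exists m, t < departure x y m.
  by exists b; rewrite (lt_trans tb)// arrival_lt_departure.
have [m tm mmin] := ex_minnP ex.
have tm1 : t < arrival x m.+1.
  rewrite ltNge; apply/negP => m1t.
  suff /eqP : m = m.+1 by rewrite ltn_eqF.
  apply: (xi_le1 k1 xik); split => //.
    by rewrite (le_trans _ m1t)// arrival_le.
  by rewrite (lt_trans tm)// departure_lt.
have : (N < m)%N by rewrite -ltnS -arrival_lt (le_lt_trans Nt).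
case: m => // m in tm mmin tm1 *; rewrite ltnS => Nm.
have mt : departure x y m <= t.
  by rewrite leNgt; apply/negP => /mmin; rewrite ltnn.
pose p j := (N <= j)%N && (departure x y j < arrival x j.+2).
have pm : p m by rewrite /p Nm (le_lt_trans mt).
have [j /andP[Nj dj] jmin] := ex_minnP (ex_intro p m pm).
apply: (@le_trans _ _ (departure x y j)%:E); last first.
  by rewrite lee_fin (le_trans _ mt)// departure_le jmin.
apply: ereal_inf_lbound; exists (departure x y j) => //.
have early i : (i < j)%N -> (N <= i)%N -> arrival x i.+2 <= departure x y i.
  move=> ij Ni; rewrite leNgt; apply/negP => di.
  by have := jmin i; rewrite /p Ni di leqNgt ij => /(_ isT).
have aj : arrival x j.+1 < departure x y j.
  move: Nj; rewrite leq_eqVlt => /orP[/eqP <-|]; first exact: arrival_lt_departureN.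
  case: j early {dj jmin} => // j early Nj.
  by rewrite (le_lt_trans (early j _ _))// ?departure_lt.
(* from [l] on customer [j.+1] is present and those before [j] have left *)
pose l := if j is i.+1 then Num.max (arrival x j.+1) (departure x y i)
          else arrival x j.+1.
have lj : l < departure x y j.
  rewrite /l; case: j aj {Nj dj jmin early l} => // i aj.
  by rewrite gt_max aj departure_lt ltnSn.
split.
  apply: (@xi1 _ j.+1); apply/seteqP; split=> [i [ij ji]|_ ->].
    apply/eqP; rewrite eqn_leq -ltnS -arrival_lt (le_lt_trans ij)//=.
    by rewrite -departure_lt.
  by split; [exact: ltW|rewrite departure_lt].
near=> s.
have ls : l < s by near: s; exact: nbhs_left_gt.
have sj : s < departure x y j by near: s; exact: nbhs_left_lt.
have js : arrival x j.+1 < s.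
  by move: ls; rewrite /l; case: (j) => // i; rewrite gt_max => /andP[].
apply: (@xi2 _ j j.+1); first by rewrite ltn_eqF.
apply/seteqP; split=> [i [si is_]|i [|] ->].
- have : (j <= i <= j.+1)%N.
    apply/andP; split; last first.
      by rewrite -ltnS -arrival_lt (le_lt_trans si)// (lt_trans sj).
    rewrite leqNgt; apply/negP; move: ls; rewrite /l.
    case: (j) => // h; rewrite gt_max => /andP[_ hs].
    rewrite ltnS -departure_le leNgt => /negP; apply.
    exact: lt_trans is_.
  by rewrite leq_eqVlt andb_orl => /orP[/andP[/eqP -> _]|];
    [left|right; apply/eqP; rewrite eqn_leq andbC].
- by split => //; rewrite ltW// (lt_trans _ js)// arrival_lt.
- by split; [exact: ltW|rewrite (lt_trans sj)// departure_lt].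
Unshelve. all: by end_near. Qed.

(** A set that meets each interarrival interval in an interval has for length
the sum of the lengths of these traces; both sojourn times are of this form. *)
Lemma lebesgue_measure_pieces (E : set R) (u v : nat -> R) :
  (forall n, (n <= N)%N -> u n <= v n) ->
  (forall n, (n <= N)%N ->
     E `&` `[arrival x n, arrival x n.+1[%classic = `[u n, v n[%classic) ->
  forall n, (n <= N.+1)%N ->
    measurable (E `&` `[S0 x, arrival x n[%classic) /\
    lebesgue_measure (E `&` `[S0 x, arrival x n[%classic) =
      (\sum_(i < n) (v i - u i))%:E.
Proof.
move=> uv Euv; elim=> [_|n IH]; first by rewrite set_itvxx setI0 big_ord0 measure0.
rewrite ltnS => nN; have [mE lE] := IH (leqW nN).
have -> : `[S0 x, arrival x n.+1[%classic =
    `[S0 x, arrival x n[%classic `|` `[arrival x n, arrival x n.+1[%classic.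
  by rewrite -itv_bndbnd_setU// bnd_simp arrival_le.
rewrite setIUr Euv//; split; first exact: measurableU.
rewrite measureU//; last first.
  rewrite -Euv// setIACA (_ : `[_, _[%classic `&` _ = set0) ?setI0//.
  apply/seteqP; split=> // t [] /=; rewrite !in_itv/= => /andP[_ tn] /andP[nt _].
  by move: tn; rewrite ltNge nt.
rewrite [X in (_ + X)%E]lebesgue_measure_itv/= lte_fin big_ord_recr/= EFinD.
rewrite -lE; congr (_ + _)%E; case: ltP => // vu.
by rewrite (le_anti (introT andP (conj vu (uv n nN)))) subrr.
Qed.

Lemma sojournE (k : nat) : (k <= 1)%N ->
  sojourn x y k = lebesgue_measure
    ([set t | xi x y t = k%:R%:E] `&` `[S0 x, arrival x N.+1[%classic).
Proof.
move=> k1; congr lebesgue_measure; apply/seteqP; split=> t.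
  move=> [St tS xik]; split=> //=; rewrite in_itv/= St/= ltNge; apply/negP => Nt.
  by have := S1_le k1 Nt xik; rewrite leNgt tS.
move=> [/= xik]; rewrite in_itv/= => /andP[St tN]; split => //.
by rewrite (lt_le_trans _ S1_ge)// lte_fin.
Qed.

Lemma sojourn_idle : sojourn x y 0 = (idle N)%:E.
Proof.
(* The minimum makes the trace on the last interval empty: customer [N] is
   still in service when it ends. *)
pose u n := Num.min (departure x y n) (arrival x n.+1).
rewrite sojournE// (proj2 (lebesgue_measure_pieces (u := u)
  (v := fun n => arrival x n.+1) _ _ (leqnn _))).
- rewrite big_ord_recr/= /idle /u min_r ?subrr ?addr0; last first.
    exact/ltW/arrival_lt_departureN.
  congr (_%:E); apply: eq_bigr => i _.
  by rewrite min_l ?departure_le_arrival// departure_alone 1?ltnW// arrivalS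
    opprD addrACA subrr add0r.
- by move=> n nN; rewrite ge_min lexx orbT.
- move=> n nN; apply/seteqP; split=> t.
    move=> [/= + tn]; rewrite (xi_alone nN)//; move: tn; rewrite !in_itv/= => /andP[nt tn].
    rewrite /u ge_min tn andbT.
    by case: ltP => [_ [] /eqP|//]; rewrite oner_eq0.
  rewrite /= !in_itv/= /u ge_min => /andP[/orP[dt|]]; last by rewrite leNgt => /negP.
  move=> tn; have nt : arrival x n <= t.
    by rewrite (le_trans _ dt)// ltW// arrival_lt_departure.
  by rewrite nt tn (xi_alone nN) ?nt// ltNge dt.
Qed.

Lemma sojourn_alone : sojourn x y 1 = (busy N + x N.+1)%:E.
Proof.
pose v n := Num.min (departure x y n) (arrival x n.+1).
rewrite sojournE// (proj2 (lebesgue_measure_pieces (u := arrival x) (v := v) _ _ (leqnn _))).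
- rewrite big_ord_recr/= /busy /v min_r; last exact/ltW/arrival_lt_departureN.
  rewrite arrivalS addrAC subrr add0r; congr (_ + _)%:E; apply: eq_bigr => i _.
  by rewrite min_l ?departure_le_arrival// departure_alone 1?ltnW// addrAC subrr add0r.
- by move=> n nN; rewrite le_min !ltW// ?arrival_lt ?arrival_lt_departure.
- move=> n nN; apply/seteqP; split=> t.
    move=> [/= + tn]; rewrite (xi_alone nN)//; move: tn; rewrite !in_itv/= => /andP[nt tn].
    by rewrite nt lt_min tn andbT; case: ltP => // _ [] /eqP; rewrite eq_sym oner_eq0.
  rewrite /= !in_itv/= lt_min => /andP[nt /andP[td tn]].
  by rewrite nt tn (xi_alone nN) ?nt// td.
Qed.

End first_cycle.

End path.

(** * The exponential law *)

Section exponential_law.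
Context (R : realType) (lambda : R) (lambda_gt0 : 0 < lambda).
Context (mu : probability R R).
Hypothesis mu_exp : forall B : set R, measurable B ->
  mu B = exponential_prob lambda B.

Local Notation leb := (@lebesgue_measure R).

Lemma exponential_dominated (nu : probability (measurableTypeR R) R) :
  (forall B, measurable B -> nu B = exponential_prob lambda B) -> nu `<< leb.
Proof.
move=> nuE; apply/null_content_dominatesP => A mA A0.
rewrite nuE// /exponential_prob; apply: null_set_integral => //.
by apply/measurable_EFinP/measurable_funTS; exact: measurable_exponential_pdf.
Qed.

Lemma integral_exponential_density (nu : probability (measurableTypeR R) R)
    (f : R -> \bar R) (D : set (measurableTypeR R)) :
  (forall B, measurable B -> nu B = exponential_prob lambda B) ->
  measurable D -> nu.-integrable D f ->
  (\int[nu]_(x in D) f x =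
   \int[leb]_(x in D) (f x * (exponential_pdf lambda x)%:E))%E.
Proof.
move=> nuE mD intf; have dom := exponential_dominated nuE.
rewrite -(Radon_Nikodym_change_of_variables dom)//.
have mf : measurable_fun D f by exact: measurable_int intf.
have mpdf : measurable_fun D (EFin \o exponential_pdf lambda).
  by apply/measurable_EFinP/measurable_funTS; exact: measurable_exponential_pdf.
apply: ae_eq_integral => //.
- apply: emeasurable_funM => //; apply: (measurable_int leb).
  apply: (integrableS _ _ (@subsetT _ _)) => //=.
  by apply: Radon_Nikodym_integrable; exact: dom.
- by apply: emeasurable_funM => //=.
- apply: ae_eqe_mul2l => /=.
  rewrite Radon_NikodymE//=; case: cid => /= h [h1 h2 h3].
  apply: integral_ae_eq => //=; first exact: integrableS h2.
  by move=> E ED mE; rewrite -h3//= nuE.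
Qed.

(** Lebesgue measure lives on the copy [measurableTypeR R] of the real line,
so the density is used after transporting [mu] there along the identity. *)
Lemma integral_exponential (f : R -> \bar R) (D : set R) :
  measurable D -> measurable_fun [set: measurableTypeR R] f ->
  mu.-integrable D f ->
  (\int[mu]_(x in D) f x =
   \int[leb]_(x in D) (f x * (exponential_pdf lambda x)%:E))%E.
Proof.
move=> mD mf intf.
pose i : {mfun R >-> measurableTypeR R} :=
  HB.pack (id : R -> measurableTypeR R)
    (isMeasurableFun.Build _ _ R (measurableTypeR R) id (@measurable_id _ R setT)).
rewrite -(@integral_exponential_density (distribution mu i))//.
- by rewrite integral_pushforward.
- exact: integrable_pushforward.
Qed.

Lemma exponential_lt0 : mu `]-oo, 0[%classic = 0%E.
Proof.
rewrite mu_exp//; apply: integral0_eq => x /=; rewrite in_itv/= => x0.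
by rewrite lt0_exponential_pdf.
Qed.

Lemma exponential_set1 (r : R) : mu [set r] = 0%E.
Proof. by rewrite mu_exp//; exact: integral_set1. Qed.

Lemma exponential_le0 : mu `]-oo, 0]%classic = 0%E.
Proof.
by rewrite -(@setUitv1 _ _ _ 0 true)// measureU0//;
  [exact: exponential_lt0|exact: exponential_set1].
Qed.

Lemma exponential_itvcc (t : R) : 0 <= t ->
  mu `[0, t]%classic = (1 - expR (- (lambda * t)))%:E.
Proof.
rewrite le_eqVlt => /orP[/eqP <-|t0].
  by rewrite set_itv1 exponential_set1 mulr0 oppr0 expR0 subrr.
by rewrite mu_exp// exponential_prob_itv0c// mulNr EFinB.
Qed.

Lemma exponential_tail (t : R) : 0 <= t ->
  mu `]t, +oo[%classic = (expR (- (lambda * t)))%:E.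
Proof.
move=> t0; rewrite -setCitvl probability_setC//.
rewrite (@itv_bndbnd_setU _ _ _ (BLeft 0))//.
rewrite measureU//; last first.
  by apply/seteqP; split=> // z [] /=; rewrite !in_itv/= => z0 /andP[]; rewrite leNgt z0.
rewrite [X in (1 - (X + _))%E](_ : _ = 0%E); last exact: exponential_lt0.
rewrite [X in (1 - (_ + X))%E](_ : _ = (1 - expR (- (lambda * t)))%:E); last first.
  exact: exponential_itvcc.
by rewrite add0e -EFinB opprB addrCA subrr addr0.
Qed.

Lemma exponential_tailc (t : R) : 0 <= t ->
  mu `[t, +oo[%classic = (expR (- (lambda * t)))%:E.
Proof.
move=> t0; rewrite -(@setU1itv _ _ _ t false)// measureU//.
- by rewrite [X in (X + _)%E]exponential_set1 add0e; exact: exponential_tail.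
- by apply/seteqP; split=> // z [] /= ->; rewrite in_itv/= ltxx.
Qed.

(** With [b - a] the remaining idle time before level [t], this is the
contribution to [idle_step] of the paths that stay below the level. The
integrand times the density of the exponential law has the explicit primitive
[F] below. *)
Lemma integral_exponential_tilt (q a b : R) : 0 <= q -> 0 <= a -> a <= b ->
  (\int[mu]_(x in `[a, b]) ((1 - q) * expR (- (lambda * q * (b - x))))%:E =
   (expR (- (lambda * a)) * expR (- (lambda * q * (b - a)))
      - expR (- (lambda * b)))%:E)%E.
Proof.
move=> q0 a0; set phi := fun x => (1 - q) * expR (- (lambda * q * (b - x))).
have cE (c d : R) : continuous (fun x => expR (c + d * x)).
  move=> z; apply: continuous_comp; last exact: continuous_expR.
  apply: (@continuousD _ R^o R^o); first exact: cst_continuous.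
  by apply: (@continuousM _ R^o) => //; exact: cst_continuous.
have phiE : phi = (fun x => (1 - q) * expR (- (lambda * q * b) + (lambda * q) * x)).
  by apply/funext => x; rewrite /phi; congr (_ * expR _); ring.
have cphi : continuous phi.
  rewrite phiE => z.
  apply: (@continuousM _ R^o (fun=> 1 - q)
    (fun x => expR (- (lambda * q * b) + lambda * q * x))); last exact: cE.
  exact: cst_continuous.
have mphi : measurable_fun [set: R] (EFin \o phi).
  by apply/measurable_EFinP; exact: continuous_measurable_fun.
rewrite le_eqVlt => /orP[/eqP ab|ab].
  rewrite ab subrr mulr0 oppr0 expR0 mulr1 subrr.
  apply: null_set_integral => //; last by rewrite set_itv1; exact: exponential_set1.
  exact: measurable_funTS mphi.
pose F x := - expR (- (lambda * q * b) + (lambda * q - lambda) * x).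
have dF (z : R^o) : is_derive z 1 (F : R^o -> R^o) (lambda * (1 - q) * - F z).
  rewrite /F opprK; apply: is_derive_eq.
  by rewrite add0r mul1r /GRing.scale/= mulr1; ring.
have intphi : mu.-integrable `[a, b]%classic (EFin \o phi).
  apply: measurable_bounded_integrable => //.
  - by rewrite ltey_eq fin_num_measure.
  - by apply: measurable_funTS; exact: (continuous_measurable_fun cphi).
  - exists `|1 - q|; split; first exact: num_real.
    move=> M /ltW qM x /=; rewrite in_itv/= => /andP[ax xb].
    rewrite /phi normrM (le_trans _ qM)// ler_piMr// ger0_norm ?expR_ge0//.
    by rewrite -expR0 ler_expR oppr_le0 !mulr_ge0 ?(ltW lambda_gt0)// subr_ge0.
rewrite integral_exponential//.
transitivity (\int[leb]_(x in `[a, b])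
   (lambda * (1 - q) * - F x)%:E)%E.
  apply: eq_integral => z; rewrite inE/= in_itv/= => /andP[az zb].
  rewrite -EFinM exponential_pdfE ?(le_trans a0)//; congr _%:E.
  rewrite /F opprK mulrACA -expRD [(1 - q) * _]mulrC; congr (_ * expR _).
  by ring.
rewrite (@continuous_FTC2 _ _ F)//.
- rewrite /F -EFinB opprK -expRD addrC; congr (expR _ - expR _)%:E; ring.
- apply: continuous_subspaceT => z; apply: (@continuousM _ R^o
      (fun=> lambda * (1 - q)) (fun x => - F x)).
    exact: cst_continuous.
  by apply: continuousN => /=; apply: continuousN; exact: cE.
- split=> [z _||].
  + by have [] := dF z.
  + by apply/cvg_at_right_filter; apply: cvgN; exact: cE.
  + by apply/cvg_at_left_filter; apply: cvgN; exact: cE.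
- by move=> z _; rewrite derive1E; have [_ ->] := dF z.
Qed.

End exponential_law.

(** * Service times and the probability of overtaking *)

Section discounting.
Context d (T : measurableType d) (R : realType).

Lemma measurable_discount (c : R) (f : T -> R) : measurable_fun setT f ->
  measurable_fun setT (fun w => expR (- (c * f w))).
Proof.
move=> mf; have mc : measurable_fun setT (fun x => expR (- (c * x))).
  apply: continuous_measurable_fun => x.
  apply: continuous_comp; last exact: continuous_expR.
  apply: (@continuousN _ R^o); apply: (@continuousM _ R^o) => //.
  exact: cst_continuous.
exact: measurableT_comp mc mf.
Qed.

Lemma measurable_toE (f : T -> R) : measurable_fun setT f ->
  measurable_fun setT (fun w => (f w)%:E).
Proof. by move=> mf; apply: (measurableT_comp (f := EFin)). Qed.

End discounting.

Section boolean_events.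
Context d (T : measurableType d) (R : realType) (P : probability T R).
Implicit Type b : T -> bool.

Lemma measurable_bool b : measurable_fun setT b -> measurable [set w | b w].
Proof. by move=> mb; have := mb measurableT [set true] I; rewrite setTI. Qed.

Lemma probability_bool b : measurable_fun setT b ->
  P [set w | b w] = (\int[P]_w (if b w then 1 else 0)%:E)%E.
Proof.
move=> /measurable_bool mb.
rewrite -[in LHS](setTI [set w | b w]) setIC -integral_indic//.
apply: eq_integral => w _; rewrite indicE; case: ifPn => bw.
  by rewrite mem_set.
by rewrite memNset//=; exact/negP.
Qed.

End boolean_events.

Section distribution_function.
Context (R : realType).

Lemma eq_probability_itvNyo (P Q : probability R R) :
  (forall t, P `]-oo, t[%classic = Q `]-oo, t[%classic) ->
  forall B : set R, measurable B -> P B = Q B.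
Proof.
move=> PQ B mB.
apply: (measure_unique (@RGenInftyO.G R) (fun n => `]-oo, n%:R[%classic)) => //.
- exact: RGenInftyO.measurableE.
- move=> _ _ [a ->] [b ->]; exists (Num.min a b).
  by apply/seteqP; split=> z /=; rewrite !in_itv/= lt_min => /andP.
- by move=> n; exists n%:R.
- apply/seteqP; split=> // z _; exists (Num.bound `|z|) => //=.
  by rewrite in_itv/= (le_lt_trans (ler_norm z))// archi_boundP.
- by move=> _ [t ->]; exact: PQ.
- by move=> n; rewrite ltey_eq fin_num_measure.
Qed.

Lemma probability_le0 (P : probability R R) (G : R -> R) :
  (forall t, P `]-oo, t[%classic = (G t)%:E) -> G t @[t --> 0^'+] --> (0 : R) ->
  P `]-oo, 0]%classic = 0%E.
Proof.
move=> PG G0; apply/eqP; rewrite eq_le measure_ge0 andbT.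
apply/lee_addgt0Pr => e e0; rewrite add0e.
near (0 : R)^'+ => t.
have t0 : 0 < t by near: t; exact: nbhs_right_gt.
apply: (@le_trans _ _ (P `]-oo, t[%classic)).
  by apply: le_measure; rewrite ?inE//; apply: subset_itvl; rewrite bnd_simp.
rewrite PG lee_fin ltW//; near: t.
exact: (cvgr_lt 0).
Unshelve. all: by end_near. Qed.

End distribution_function.

Section race.
Context (R : realType) (lambda : R) (lambda_gt0 : 0 < lambda).
Context d (T : measurableType d) (P : probability T R) (tau eta : {RV P >-> R}).
Hypothesis tau_exp : exponentially_distributed lambda tau.
Hypothesis indep : mutually_independent P (fun b : bool => if b then tau else eta).

Lemma race_independent (A B : set R) : measurable A -> measurable B ->
  P (eta @^-1` A `&` tau @^-1` B) =
  (distribution P eta A * distribution P tau B)%E.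
Proof.
move=> mA mB.
have mAB (b : bool) : measurable (if b then B else A) by case: b.
have := indep (s := [:: false; true]) isT mAB.
rewrite !big_cons big_nil mule1/= => <-; congr (P _).
apply/seteqP; split=> w.
  by move=> [Aw Bw] [] _.
by move=> ABw; split; [exact: (ABw false)|exact: (ABw true)].
Qed.

Hypothesis eta_gt0 : distribution P eta `]-oo, 0]%classic = 0%E.
Variable (q : R).
Hypothesis q_def : P [set w | tau w < eta w] = q%:E.

Lemma race_ge0 : 0 <= q.
Proof. by rewrite -lee_fin -q_def. Qed.

Lemma race_compl : P [set w | eta w <= tau w] = (1 - q)%:E.
Proof.
have mlt : measurable [set w | tau w < eta w].
  by apply/measurable_bool/measurable_fun_ltr; exact: measurable_funP.
rewrite EFinB -q_def -probability_setC//; congr (P _).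
by apply/seteqP; split=> w /=; rewrite leNgt => /negP.
Qed.

Lemma race_le1 : q <= 1.
Proof. by rewrite -subr_ge0 -lee_fin -race_compl. Qed.

(** Given [eta = y], with [0 < y], the probability of [y <= tau] is
[expR (- (lambda * y))]. *)
Lemma laplace_race :
  (\int[distribution P eta]_y (expR (- (lambda * y)))%:E = (1 - q)%:E)%E.
Proof.
have meta : measurable_fun [set: T] eta by exact: measurable_funP.
have mexp : measurable_fun [set: R] (fun y => expR (- (lambda * y))).
  exact: measurable_discount.
rewrite ge0_integral_distribution//=; last exact: measurable_toE.
pose b (p : R * R) : R := if p.1 <= p.2 then 1 else 0.
have mb : measurable_fun [set: R * R] b.
  by apply: measurable_fun_ifT => //; exact: measurable_fun_ler.
have mf := measurable_toE mb.
pose f p := (b p)%:E.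
have f0 p : (0 <= f p)%E by rewrite /f /b lee_fin; case: ifP.
have mF := measurable_fun_fubini_tonelli_F (m2 := distribution P tau) f mf f0.
transitivity (\int[P]_w \int[distribution P tau]_x f (eta w, x))%E.
  apply: ae_eq_integral => //.
  - by apply: measurable_toE; exact: measurable_discount.
  - exact: measurableT_comp mF meta.
  - have : {ae P, forall w, 0 < eta w}.
      exists (eta @^-1` `]-oo, 0]%classic); split=> //.
        by rewrite -[_ @^-1` _]setTI; exact: meta.
      by move=> w /=; rewrite in_itv/= => /negP; rewrite -leNgt.
    apply: filterS => w eta0 _.
    rewrite -(exponential_tailc (mu := distribution P tau) tau_exp (ltW eta0)).
    have mtail : measurable_fun setT (fun x => eta w <= x).
      by apply: measurable_fun_ler.
    rewrite -(probability_bool (distribution P tau) mtail).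
    congr (_ _); apply/seteqP; split=> x /=; by rewrite in_itv/= andbT.
rewrite -(@ge0_integral_independent _ _ _ _ _ _ _ P eta tau)//.
  rewrite -race_compl probability_bool//.
  by apply: measurable_fun_ler; exact: measurable_funP.
exact: race_independent.
Qed.

(** The condition [G(+0) = 0] leaves a positive [t] with [G t < 1]; then
[tau <= t / 2] and [t <= eta] hold together with positive probability. *)
Lemma race_gt0 (G : R -> R) : (forall t, P [set w | eta w < t] = (G t)%:E) ->
  G t @[t --> 0^'+] --> (0 : R) -> 0 < q.
Proof.
move=> eta_law G0.
near (0 : R)^'+ => t.
have t0 : 0 < t by near: t; exact: nbhs_right_gt.
have Gt : G t < 1 by near: t; apply: (cvgr_lt 0).
have t2 : 0 < t / 2 by rewrite divr_gt0.
rewrite -lte_fin -q_def.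
have mlt : measurable [set w | tau w < eta w].
  by apply/measurable_bool/measurable_fun_ltr; exact: measurable_funP.
have mpre (Z : {RV P >-> R}) (B : set R) : measurable B -> measurable (Z @^-1` B).
  by move=> mB; rewrite -[_ @^-1` _]setTI; exact: measurable_funP.
apply: (@lt_le_trans _ _
  (P (eta @^-1` `[t, +oo[%classic `&` tau @^-1` `[0, t / 2]%classic))); last first.
  apply: le_measure; rewrite ?inE//; first by apply: measurableI; exact: mpre.
  move=> w [] /=; rewrite !in_itv/= andbT => te /andP[_ tt].
  by rewrite (le_lt_trans tt)// (lt_le_trans _ te)// ltr_pdivrMr// mulr_natr mulr2n ltrDl.
rewrite race_independent// mule_gt0//.
  rewrite -setCitvl probability_setC//.
  rewrite [X in (1 - X)%E](_ : _ = (G t)%:E); last first.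
    by rewrite -eta_law; congr (P _); apply/seteqP; split=> w /=; rewrite in_itv.
  by rewrite -EFinB lte_fin subr_gt0.
rewrite [ltRHS](exponential_itvcc (mu := distribution P tau) tau_exp (ltW t2)).
by rewrite lte_fin subr_gt0 -[ltRHS]expR0 ltr_expR oppr_lt0 mulr_gt0.
Unshelve. all: by end_near. Qed.

End race.

(** * Recursion over the customers *)

Section measurable_path.
Context d (T : measurableType d) (R : realType) (x y : nat -> T -> R) (n : nat).
Hypothesis mx : forall i, (i < n)%N -> measurable_fun setT (x i.+1).
Hypothesis my : forall i, (i < n)%N -> measurable_fun setT (y i).

Lemma measurable_idle : measurable_fun setT (fun w => idle (x ^~ w) (y ^~ w) n).
Proof.
elim: n mx my => [|m IH] mx' my'.
  by apply: eq_measurable_fun (measurable_cst (0 : R)) => w _; rewrite /idle big_ord0.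
have -> : (fun w => idle (x ^~ w) (y ^~ w) m.+1) =
    (fun w => idle (x ^~ w) (y ^~ w) m + (x m.+1 w - y m w)).
  by apply/funext => w; rewrite idleS.
apply: measurable_funD; last by apply: measurable_funB; [exact: mx'|exact: my'].
by apply: IH => i im; [apply: mx'|apply: my']; exact: ltnW.
Qed.

Lemma measurable_busy : measurable_fun setT (fun w => busy (y ^~ w) n).
Proof.
elim: n my => [|m IH] my'.
  by apply: eq_measurable_fun (measurable_cst (0 : R)) => w _; rewrite /busy big_ord0.
have -> : (fun w => busy (y ^~ w) m.+1) = (fun w => busy (y ^~ w) m + y m w).
  by apply/funext => w; rewrite busyS.
apply: measurable_funD; last exact: my'.
by apply: IH => i im; apply: my'; exact: ltnW.
Qed.

Lemma measurable_alone :
  measurable_fun setT (fun w => `[< alone (x ^~ w) (y ^~ w) n >]).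
Proof.
elim: n mx my => [|m IH] mx' my'.
  apply: eq_measurable_fun (measurable_cst true) => w _.
  by apply/esym/asboolP.
have -> : (fun w => `[< alone (x ^~ w) (y ^~ w) m.+1 >]) =
    (fun w => `[< alone (x ^~ w) (y ^~ w) m >] && (y m w <= x m.+1 w)).
  apply/funext => w; rewrite -[y m w <= _]asboolb -asbool_and.
  by apply: asbool_equiv_eq; exact: aloneS.
apply: measurable_and; last first.
  by apply: measurable_fun_ler; [exact: my'|exact: mx'].
by apply: IH => i im; [apply: mx'|apply: my']; exact: ltnW.
Qed.

End measurable_path.

Section recursion.
Context (R : realType) (lambda : R).
Context d (T : measurableType d) (P : probability T R).
Context (X Y : nat -> {RV P >-> R}) (muX muY : probability R R) (q : R).

Definition marks (i : nat + nat) : {RV P >-> R} :=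
  match i with inl n => X n | inr n => Y n end.

Hypotheses (lambda_gt0 : 0 < lambda)
  (q_ge0 : 0 <= q) (q_le1 : q <= 1)
  (muX_exp : forall B, measurable B -> muX B = exponential_prob lambda B)
  (muY_le0 : muY `]-oo, 0]%classic = 0%E)
  (muY_laplace : (\int[muY]_y (expR (- (lambda * y)))%:E = (1 - q)%:E)%E)
  (X_law : forall n B, measurable B -> P (X n @^-1` B) = muX B)
  (Y_law : forall n B, measurable B -> P (Y n @^-1` B) = muY B)
  (indep : mutually_independent P (fun i => marks i : T -> R)).

(** The indices of the variables that decide [alone], [idle] and [busy] at
[n]: the services [0] to [n - 1] and the interarrival times [1] to [n]. *)
Fixpoint history (n : nat) : seq (nat + nat) :=
  if n is m.+1 then [:: inl m.+1, inr m & history m] else [::].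

Lemma mem_history n i : (i \in history n) =
  match i with inl j => (0 < j <= n)%N | inr j => (j < n)%N end.
Proof.
case: i => j; elim: n => [|n IH]; first by case: j.
- rewrite /= !inE IH orFb -[inl j == _]/(j == n.+1) [(j <= n.+1)%N]leq_eqVlt ltnS.
  by rewrite andb_orr; have [->|_] := eqVneq j n.+1; rewrite ?andbF.
- by [].
- by rewrite /= !inE IH orFb -[inr j == _]/(j == n) ltnS [RHS]leq_eqVlt.
Qed.

Lemma uniq_history n : uniq (inl n.+1 :: inr n :: history n).
Proof.
elim: n => [//|n IH]; rewrite [history _]/= cons_uniq cons_uniq IH.
by rewrite -[inl n.+1 :: inr n :: history n]/(history n.+1) inE !mem_history/= !ltnn.
Qed.

Lemma Y_gt0 n : {ae P, forall w, 0 < Y n w}.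
Proof.
exists (Y n @^-1` `]-oo, 0]%classic); split=> //.
- by rewrite -[_ @^-1` _]setTI; exact: measurable_funP.
- by rewrite Y_law.
- by move=> w /=; rewrite in_itv/= => /negP; rewrite -leNgt.
Qed.

Local Notation past := (past marks).

(** The next interarrival time is averaged first, with the current service
among the data: the average is then explicit because of the lack of memory of
the exponential law, but only for a positive service time. *)
Lemma integral_next_arrival n (f : T -> R -> R) (g : T -> R) :
  measurable_fun [set: past (inr n :: history n) * R] (fun z => f z.1 z.2) ->
  (forall w x, 0 <= f w x) -> measurable_fun [set: T] g ->
  (forall w, 0 < Y n w -> (\int[muX]_x (f w x)%:E = (g w)%:E)%E) ->
  (\int[P]_w (f w (X n.+1 w))%:E = \int[P]_w (g w)%:E)%E.
Proof.
move=> mf f0 mg fg; have mF := measurable_toE mf.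
have F0 (z : past (inr n :: history n) * R) : (0 <= (f z.1 z.2)%:E)%E.
  by rewrite lee_fin.
have := @ge0_integral_past _ _ _ P _ marks indep (inl n.+1) (inr n :: history n) muX _
  (uniq_history n) (X_law n.+1) mF F0.
rewrite /= => ->; apply: ae_eq_integral => //.
- have := measurable_fun_fubini_tonelli_F (m2 := muX) _ mF F0.
  move=> mF' _ B mB; rewrite setTI.
  apply: (@measurable_past _ _ _ _ _ marks (inr n :: history n)).
  by have := mF' measurableT B mB; rewrite setTI.
- exact: measurable_toE.
- by apply: filterS (Y_gt0 n) => w Yw _; exact: fg.
Qed.

Lemma integral_next_service n (V : T -> R) :
  measurable_fun [set: past (history n)] V -> (forall w, 0 <= V w) ->
  (\int[P]_w (V w * expR (- (lambda * Y n w)))%:E = \int[P]_w (V w)%:E * (1 - q)%:E)%E.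
Proof.
move=> mV V0.
have mF : measurable_fun [set: past (history n) * R]
    (fun z => V z.1 * expR (- (lambda * z.2))).
  apply: measurable_funM; first exact: measurableT_comp mV measurable_fst.
  by apply: measurable_discount; exact: measurable_snd.
have F0 (z : past (history n) * R) : (0 <= (V z.1 * expR (- (lambda * z.2)))%:E)%E.
  by rewrite lee_fin mulr_ge0// expR_ge0.
have un : uniq (inr n :: history n) by have /andP[] := uniq_history n.
have := @ge0_integral_past _ _ _ P _ marks indep (inr n) (history n) muY _
  un (Y_law n) (measurable_toE mF) F0.
rewrite /= => ->.
have mVT : measurable_fun [set: T] V.
  move=> _ B mB; rewrite setTI; apply: (@measurable_past _ _ _ _ _ marks (history n)).
  by have := mV measurableT B mB; rewrite setTI.
rewrite muleC -ge0_integralZl//; last 3 first.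
- exact: measurable_toE.
- by move=> w _; rewrite lee_fin.
- by rewrite -muY_laplace; apply: integral_ge0 => y _; rewrite lee_fin expR_ge0.
apply: eq_integral => w _; rewrite -muY_laplace muleC -ge0_integralZl//.
- by apply: measurable_toE; exact: measurable_discount.
- by rewrite lee_fin.
Qed.

Let a n w := `[< alone (X ^~ w) (Y ^~ w) n >].
Let rho n w := idle (X ^~ w) (Y ^~ w) n.
Let sig n w := busy (Y ^~ w) n.

Lemma past_measurable d' (T' : measurableType d') s (f : T -> T') :
  measurable_fun [set: past s] f -> measurable_fun [set: T] f.
Proof.
move=> mf _ B mB; rewrite setTI; apply: (@measurable_past _ _ _ _ _ marks s).
by have := mf measurableT B mB; rewrite setTI.
Qed.

Lemma measurable_at_past d' (T' : measurableType d') s (f : T -> T') :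
  measurable_fun [set: past s] f ->
  measurable_fun [set: past s * R] (fun z => f z.1).
Proof. by move=> mf; exact: measurableT_comp mf measurable_fst. Qed.

Section measurable_history.
Variables (s : seq (nat + nat)) (n : nat).
Hypothesis history_s : {subset history n <= s}.

Let mX i : (i < n)%N -> measurable_fun [set: past s] (X i.+1).
Proof.
move=> im; apply: (@measurable_past_coord _ _ _ _ _ marks s (inl i.+1)).
by apply: history_s; rewrite mem_history.
Qed.

Let mY i : (i < n)%N -> measurable_fun [set: past s] (Y i).
Proof.
move=> im; apply: (@measurable_past_coord _ _ _ _ _ marks s (inr i)).
by apply: history_s; rewrite mem_history.
Qed.

Lemma measurable_alone_past : measurable_fun [set: past s] (a n).
Proof. exact: (measurable_alone (T := past s)). Qed.

Lemma measurable_idle_past : measurable_fun [set: past s] (rho n).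
Proof. exact: (measurable_idle (T := past s)). Qed.

Lemma measurable_busy_past : measurable_fun [set: past s] (sig n).
Proof. exact: (measurable_busy (T := past s)). Qed.

End measurable_history.

Lemma alone_next n w : a n.+1 w = a n w && (Y n w <= X n.+1 w).
Proof.
rewrite /a -[Y n w <= _]asboolb -asbool_and.
by apply: asbool_equiv_eq; exact: aloneS.
Qed.

Lemma alone0 w : a 0 w = true.
Proof. by apply/asboolP. Qed.

Lemma measurable_service_past n : measurable_fun [set: past (inr n :: history n)] (Y n).
Proof.
apply: (@measurable_past_coord _ _ _ _ _ marks _ (inr n)).
by rewrite inE eqxx.
Qed.

Let sub_history n : {subset history n <= inr n :: history n}.
Proof. by move=> i ni; rewrite inE ni orbT. Qed.

(** Each customer is overtaken with probability [q], independently of the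
past. *)
Lemma probability_alone n : P [set w | a n w] = ((1 - q) ^+ n)%:E.
Proof.
elim: n => [|n IH].
  rewrite expr0 -(probability_setT P); congr (P _); apply/seteqP; split=> // w _.
  by rewrite /= alone0.
have ma m : measurable_fun [set: T] (a m).
  by apply: past_measurable; exact: (@measurable_alone_past (history m) m (fun _ => id)).
rewrite probability_bool//.
pose f w x : R := if a n w && (Y n w <= x) then 1 else 0.
pose g w := (if a n w then 1 else 0) * expR (- (lambda * Y n w)).
transitivity (\int[P]_w (f w (X n.+1 w))%:E)%E.
  by apply: eq_integral => w _; rewrite /f alone_next.
rewrite (integral_next_arrival (g := g)).
- rewrite /g integral_next_service.
  + by rewrite -probability_bool// IH -EFinM exprSr.
  + by apply: measurable_fun_ifT => //; exact: (@measurable_alone_past _ n (fun _ => id)).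
  + by move=> w; case: ifP.
- apply: measurable_fun_ifT => //; apply: measurable_and.
    exact: (measurable_at_past (measurable_alone_past (@sub_history n))).
  apply: measurable_fun_ler; last exact: measurable_snd.
  exact: (measurable_at_past (@measurable_service_past n)).
- by move=> w x; rewrite /f; case: ifP.
- apply: measurable_funM; first exact: measurable_fun_ifT.
  by apply: measurable_discount; exact: measurable_funP.
- move=> w Yw; rewrite /f /g; case: (a n w) => /=; last first.
    by rewrite mul0r integral0.
  rewrite mul1r -(exponential_tailc muX_exp (ltW Yw)).
  have mle : measurable_fun [set: R] (fun x => Y n w <= x).
    exact: measurable_fun_ler.
  rewrite -(probability_bool muX mle).
  by congr (_ _); apply/seteqP; split=> x /=; rewrite in_itv/= andbT.
Qed.

Section level.
Variable t : R.

(** Up to the factor [1 - q], the probability that the idle time ends above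
[t] given the history of [n] customers, on the event that it is not above [t]
yet and that nobody has been overtaken so far. *)
Definition idle_mass n w : R :=
  if a n w && (rho n w <= t) then expR (- (lambda * q * (t - rho n w))) else 0.

(** The level [t] is passed during the idle period that follows the service of
customer [n]. *)
Definition idle_exit n w : bool :=
  [&& a n.+1 w, rho n w <= t & t < rho n.+1 w].

Lemma measurable_idle_mass n : measurable_fun [set: past (history n)] (idle_mass n).
Proof.
have ma := @measurable_alone_past _ n (fun _ => id).
have mr := @measurable_idle_past _ n (fun _ => id).
apply: measurable_fun_ifT => //.
  by apply: measurable_and => //; exact: measurable_fun_ler.
by apply: measurable_discount; exact: measurable_funB.
Qed.

Lemma idle_mass_ge0 n w : 0 <= idle_mass n w.
Proof. by rewrite /idle_mass; case: ifP => // _; exact: expR_ge0. Qed.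

Lemma measurable_idle_exit n : measurable_fun [set: T] (idle_exit n).
Proof.
have mr m : measurable_fun [set: T] (rho m).
  by apply: past_measurable; exact: (@measurable_idle_past (history m) m (fun _ => id)).
apply: measurable_and.
  by apply: past_measurable; exact: (@measurable_alone_past (history n.+1) n.+1 (fun _ => id)).
by apply: measurable_and; [exact: measurable_fun_ler|exact: measurable_fun_ltr].
Qed.

(** From idle time [rho n w <= t], customer [n] is not overtaken with
probability [1 - q], and the next idle period is then exponential: either it
stays below level [t], which gives [idle_mass n.+1], or it passes it. The
corresponding averages over the interarrival time are [g1] and [g2]; their sum
is [idle_mass n] discounted by the service time, whose average is the factor
[1 - q]. *)
Lemma idle_step n :
  (\int[P]_w ((1 - q) * idle_mass n w)%:E =
   \int[P]_w ((1 - q) * idle_mass n.+1 w)%:E + P [set w | idle_exit n w])%E.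
Proof.
have p0 : 0 <= 1 - q by rewrite subr_ge0.
have ma := measurable_alone_past (@sub_history n).
have mr := measurable_idle_past (@sub_history n).
have mY := @measurable_service_past n.
have ma1 := measurable_at_past ma.
have mr1 := measurable_at_past mr.
have mY1 := measurable_at_past mY.
pose f1 w x : R := if [&& a n w, Y n w <= x & rho n w + (x - Y n w) <= t]
  then (1 - q) * expR (- (lambda * q * (t - (rho n w + (x - Y n w))))) else 0.
pose g1 w : R := if a n w && (rho n w <= t)
  then expR (- (lambda * Y n w)) * expR (- (lambda * q * (t - rho n w)))
       - expR (- (lambda * (Y n w + (t - rho n w)))) else 0.
pose f2 w x : R := if [&& a n w, rho n w <= t & Y n w + (t - rho n w) < x]
  then 1 else 0.
pose g2 w : R := if a n w && (rho n w <= t)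
  then expR (- (lambda * (Y n w + (t - rho n w)))) else 0.
have mx : measurable_fun [set: past (inr n :: history n) * R] snd.
  exact: measurable_snd.
have mb : measurable_fun [set: past (inr n :: history n)]
    (fun w => a n w && (rho n w <= t)).
  by apply: measurable_and => //; exact: measurable_fun_ler.
have mg2 : measurable_fun [set: T] g2.
  apply: (@past_measurable _ _ (inr n :: history n)); apply: measurable_fun_ifT => //.
  apply: measurable_discount; apply: measurable_funD => //.
  exact: measurable_funB.
have mg1 : measurable_fun [set: T] g1.
  apply: (@past_measurable _ _ (inr n :: history n)); apply: measurable_fun_ifT => //.
  apply: measurable_funB.
    apply: measurable_funM; apply: measurable_discount => //.
    exact: measurable_funB.
  apply: measurable_discount; apply: measurable_funD => //.
  exact: measurable_funB.
have step1 : (\int[P]_w ((1 - q) * idle_mass n.+1 w)%:E = \int[P]_w (g1 w)%:E)%E.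
  rewrite -(@integral_next_arrival n f1 g1)//.
  - apply: eq_integral => w _; congr _%:E.
    rewrite /idle_mass /f1 alone_next /rho idleS -/(rho n w) andbA.
    by case: ifP => //; rewrite mulr0.
  - apply: measurable_fun_ifT => //.
      apply: measurable_and => //; apply: measurable_and.
        exact: measurable_fun_ler.
      apply: measurable_fun_ler => //; apply: measurable_funD => //.
      exact: measurable_funB.
    apply: measurable_funM => //; apply: measurable_discount.
    apply: measurable_funB => //; apply: measurable_funD => //.
    exact: measurable_funB.
  - by move=> w x; rewrite /f1; case: ifP => // _; rewrite mulr_ge0 ?expR_ge0.
  - move=> w Yw; rewrite /f1 /g1; case: (a n w) => /=; last by rewrite integral0.
    case: leP => [rt|tr]; last first.
      apply: integral0_eq => x _; case: ifP => // /andP[Yx rx]; exfalso.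
      by lra.
    have Yb : Y n w <= Y n w + (t - rho n w) by rewrite lerDl subr_ge0.
    have := integral_exponential_tilt lambda_gt0 muX_exp q_ge0 (ltW Yw) Yb.
    rewrite [Y n w + _ - Y n w]addrC addKr => <-.
    rewrite [RHS]integral_mkcond; apply: eq_integral => x _.
    rewrite patchE mem_setE in_itv/=.
    have -> : (x <= Y n w + (t - rho n w)) = (rho n w + (x - Y n w) <= t).
      by apply/idP/idP => ?; lra.
    case: ifP => // _; congr (_ * expR (- (_ * _)))%:E; ring.
have step2 : (P [set w | idle_exit n w] = \int[P]_w (g2 w)%:E)%E.
  rewrite probability_bool; last exact: measurable_idle_exit.
  rewrite -(@integral_next_arrival n f2 g2)//.
  - apply: eq_integral => w _; congr _%:E; rewrite /f2.
    suff -> : idle_exit n w =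
      [&& a n w, rho n w <= t & Y n w + (t - rho n w) < X n.+1 w] by [].
    rewrite /idle_exit alone_next /rho idleS -/(rho n w) -andbA; congr andb.
    by apply/and3P/andP => [[Yx rt tr]|[rt Yx]]; split => //; lra.
  - apply: measurable_fun_ifT => //; apply: measurable_and => //.
    apply: measurable_and; first exact: measurable_fun_ler.
    apply: measurable_fun_ltr => //; apply: measurable_funD => //.
    exact: measurable_funB.
  - by move=> w x; rewrite /f2; case: ifP.
  - move=> w Yw; rewrite /f2 /g2; case: (a n w) => /=; last by rewrite integral0.
    case: leP => [rt|tr] /=; last by rewrite integral0.
    have Yb : 0 <= Y n w + (t - rho n w) by lra.
    rewrite -(exponential_tail muX_exp Yb).
    have mlt : measurable_fun [set: R] (fun x => Y n w + (t - rho n w) < x).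
      exact: measurable_fun_ltr.
    rewrite -(probability_bool muX mlt).
    by congr (_ _); apply/seteqP; split=> x /=; rewrite in_itv/= andbT.
rewrite step1 step2 -ge0_integralD//; last 4 first.
- move=> w _; rewrite lee_fin /g1; case: ifP => // /andP[_ rt].
  rewrite -expRD subr_ge0 ler_expR.
  have : 0 <= lambda * ((1 - q) * (t - rho n w)).
    by rewrite !mulr_ge0 ?(ltW lambda_gt0)// subr_ge0.
  lra.
- exact: measurable_toE.
- by move=> w _; rewrite lee_fin /g2; case: ifP => // _; exact: expR_ge0.
- exact: measurable_toE.
transitivity (\int[P]_w (idle_mass n w * expR (- (lambda * Y n w)))%:E)%E.
  rewrite (@integral_next_service n (idle_mass n)).
  - rewrite muleC -ge0_integralZl//.
    + exact: (measurable_toE (past_measurable (@measurable_idle_mass n))).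
    + by move=> w _; rewrite lee_fin idle_mass_ge0.
  - exact: measurable_idle_mass.
  - exact: idle_mass_ge0.
apply: eq_integral => w _; rewrite -EFinD; congr _%:E.
rewrite /idle_mass /g1 /g2; case: ifP => _; last by rewrite mul0r addr0.
by rewrite subrK mulrC.
Qed.

(** The same conditional probability for the time spent in state 1: the
clock of the next arrival runs exactly while customers are alone, so what
remains of the sojourn is exponential with parameter [lambda]. *)
Definition busy_mass n w : R :=
  if a n w && (sig n w <= t) then expR (- (lambda * (t - sig n w))) else 0.

(** The level [t] is passed while customer [n] is alone in the system, that is
before this customer leaves and before the next one arrives. *)
Definition busy_exit n w : bool :=
  [&& a n w, sig n w <= t, t < sig n.+1 w & t < sig n w + X n.+1 w].

Lemma measurable_busy_mass n : measurable_fun [set: past (history n)] (busy_mass n).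
Proof.
have ma := @measurable_alone_past _ n (fun _ => id).
have ms := @measurable_busy_past _ n (fun _ => id).
apply: measurable_fun_ifT => //.
  by apply: measurable_and => //; exact: measurable_fun_ler.
by apply: measurable_discount; exact: measurable_funB.
Qed.

Lemma busy_mass_ge0 n w : 0 <= busy_mass n w.
Proof. by rewrite /busy_mass; case: ifP => // _; exact: expR_ge0. Qed.

Lemma measurable_busy_exit n : measurable_fun [set: T] (busy_exit n).
Proof.
have ms m : measurable_fun [set: T] (sig m).
  by apply: past_measurable; exact: (@measurable_busy_past (history m) m (fun _ => id)).
have mX : measurable_fun [set: T] (X n.+1) by exact: measurable_funP.
apply: measurable_and.
  by apply: past_measurable; exact: (@measurable_alone_past (history n) n (fun _ => id)).
apply: measurable_and; first exact: measurable_fun_ler.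
apply: measurable_and; first exact: measurable_fun_ltr.
by apply: measurable_fun_ltr => //; exact: measurable_funD.
Qed.

(** With [sig n w <= t] there are two cases for customer [n]: a service that
ends below the level, during which nobody must arrive ([g1]), or one that passes
it, in which case nobody must arrive before the level ([g2]). The averages over
the interarrival time are both [expR (- (lambda * (t - sig n w)))], whatever the
service time. *)
Lemma busy_step n :
  (\int[P]_w (busy_mass n w)%:E =
   \int[P]_w (busy_mass n.+1 w)%:E + P [set w | busy_exit n w])%E.
Proof.
have ma := measurable_alone_past (@sub_history n).
have ms := measurable_busy_past (@sub_history n).
have mY := @measurable_service_past n.
have ma1 := measurable_at_past ma.
have ms1 := measurable_at_past ms.
have mY1 := measurable_at_past mY.
have mx : measurable_fun [set: past (inr n :: history n) * R] snd.
  exact: measurable_snd.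
pose f1 w x : R := if [&& a n w, Y n w <= x & sig n w + Y n w <= t]
  then expR (- (lambda * (t - (sig n w + Y n w)))) else 0.
pose g1 w : R := if [&& a n w, sig n w <= t & sig n w + Y n w <= t]
  then expR (- (lambda * (t - sig n w))) else 0.
pose f2 w x : R :=
  if [&& a n w, sig n w <= t, t < sig n w + Y n w & t - sig n w < x]
  then 1 else 0.
pose g2 w : R := if [&& a n w, sig n w <= t & t < sig n w + Y n w]
  then expR (- (lambda * (t - sig n w))) else 0.
have mg1 : measurable_fun [set: T] g1.
  apply: (@past_measurable _ _ (inr n :: history n)); apply: measurable_fun_ifT => //.
    apply: measurable_and => //; apply: measurable_and; first exact: measurable_fun_ler.
    by apply: measurable_fun_ler => //; exact: measurable_funD.
  by apply: measurable_discount; exact: measurable_funB.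
have mg2 : measurable_fun [set: T] g2.
  apply: (@past_measurable _ _ (inr n :: history n)); apply: measurable_fun_ifT => //.
    apply: measurable_and => //; apply: measurable_and; first exact: measurable_fun_ler.
    by apply: measurable_fun_ltr => //; exact: measurable_funD.
  by apply: measurable_discount; exact: measurable_funB.
have step1 : (\int[P]_w (busy_mass n.+1 w)%:E = \int[P]_w (g1 w)%:E)%E.
  rewrite -(@integral_next_arrival n f1 g1)//.
  - apply: eq_integral => w _; congr _%:E.
    by rewrite /busy_mass /f1 alone_next /sig busyS -/(sig n w) andbA.
  - apply: measurable_fun_ifT => //.
      apply: measurable_and => //; apply: measurable_and.
        exact: measurable_fun_ler.
      by apply: measurable_fun_ler => //; exact: measurable_funD.
    apply: measurable_discount.
    by apply: measurable_funB => //; exact: measurable_funD.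
  - by move=> w x; rewrite /f1; case: ifP => // _; rewrite expR_ge0.
  - move=> w Yw; rewrite /f1 /g1; case: (a n w) => /=; last by rewrite integral0.
    have [sYt|_] := leP (sig n w + Y n w) t; last first.
      by rewrite !andbF; apply: integral0_eq => x _; rewrite andbF.
    have -> : sig n w <= t by lra.
    have mle : measurable_fun [set: R] (fun x => Y n w <= x).
      exact: measurable_fun_ler.
    transitivity (\int[muX]_x ((expR (- (lambda * (t - (sig n w + Y n w)))))%:E *
        (if Y n w <= x then 1 else 0 : R)%:E))%E.
      apply: eq_integral => x _; rewrite andbT -EFinM; congr _%:E.
      by case: ifP => _; rewrite ?mulr1 ?mulr0.
    have mif : measurable_fun [set: R] (fun x => if Y n w <= x then 1 else 0 : R).
      exact: measurable_fun_ifT.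
    rewrite ge0_integralZl//=; last 2 first.
    + exact: measurable_toE mif.
    + by move=> x _; case: ifP.
    rewrite -(probability_bool muX mle).
    have -> : [set x | Y n w <= x] = `[Y n w, +oo[%classic.
      by apply/seteqP; split=> x /=; rewrite in_itv/= andbT.
    rewrite [X in (_ * X)%E](exponential_tailc muX_exp (ltW Yw)) -EFinM -expRD.
    by congr (expR _)%:E; ring.
have step2 : (P [set w | busy_exit n w] = \int[P]_w (g2 w)%:E)%E.
  rewrite probability_bool; last exact: measurable_busy_exit.
  rewrite -(@integral_next_arrival n f2 g2)//.
  - apply: eq_integral => w _; congr _%:E.
    by rewrite /f2 /busy_exit /sig busyS -/(sig n w) ltrBlDl.
  - apply: measurable_fun_ifT => //; apply: measurable_and => //.
    apply: measurable_and; first exact: measurable_fun_ler.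
    apply: measurable_and.
      by apply: measurable_fun_ltr => //; exact: measurable_funD.
    by apply: measurable_fun_ltr => //; exact: measurable_funB.
  - by move=> w x; rewrite /f2; case: ifP.
  - move=> w Yw; rewrite /f2 /g2; case: (a n w) => /=; last by rewrite integral0.
    case: (leP (sig n w) t) => [st|ts] /=; last by rewrite integral0.
    case: (ltP t (sig n w + Y n w)) => [_|_] /=; last by rewrite integral0.
    have ts : 0 <= t - sig n w by rewrite subr_ge0.
    rewrite -(exponential_tail muX_exp ts).
    have mlt : measurable_fun [set: R] (fun x => t - sig n w < x).
      exact: measurable_fun_ltr.
    rewrite -(probability_bool muX mlt).
    by congr (_ _); apply/seteqP; split=> x /=; rewrite in_itv/= andbT.
rewrite step1 step2 -ge0_integralD//; last 4 first.
- by move=> w _; rewrite lee_fin /g1; case: ifP => // _; exact: expR_ge0.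
- exact: measurable_toE.
- by move=> w _; rewrite lee_fin /g2; case: ifP => // _; exact: expR_ge0.
- exact: measurable_toE.
apply: eq_integral => w _; rewrite -EFinD; congr _%:E.
rewrite /busy_mass /g1 /g2; case: (a n w) => /=; last by rewrite addr0.
case: (leP (sig n w) t) => _ /=; last by rewrite addr0.
by case: (leP (sig n w + Y n w) t) => _; rewrite ?addr0 ?add0r.
Qed.

End level.

Hypothesis q_gt0 : 0 < q.

Lemma alone_vanishing (M : nat -> \bar R) :
  (forall n, 0 <= M n <= P [set w | a n w])%E -> M n @[n --> \oo] --> 0%E.
Proof.
move=> MP; apply: (@squeeze_cvge _ _ _ _ (fun=> 0%E) _ (fun n => ((1 - q) ^+ n)%:E)).
- by apply: nearW => n; rewrite -probability_alone; exact: MP.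
- exact: cvg_cst.
- apply: cvg_EFin; first exact: nearW.
  apply: (@cvg_expr R (1 - q)).
  by rewrite ger0_norm ?subr_ge0// ltrBlDr ltrDl.
Qed.

(** The recursion telescopes: the probabilities of the disjoint events [D n]
add up to [M 0], since [M n] vanishes in the limit. The event [G] is there
because accumulated times increase only on paths with positive service
times. *)
Lemma exit_probability (M : nat -> \bar R) (D : nat -> set T) (G : set T) :
  (forall n, measurable (D n)) -> measurable G -> P G = 1%E ->
  (forall m n w, (m < n)%N -> G w -> D m w -> D n w -> False) ->
  (forall n, M n = M n.+1 + P (D n))%E -> M n @[n --> \oo] --> 0%E ->
  P (G `&` \bigcup_n D n) = M 0%N.
Proof.
move=> mD mG G1 GD step M0.
have PG n : P (G `&` D n) = P (D n).
  have PC : P (~` G) = 0%E by rewrite probability_setC// G1 subee.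
  have -> : P (D n) = (P (D n `\` G) + P (D n `&` G))%E by exact: measureDI.
  rewrite [X in (X + _)%E](_ : _ = 0%E) ?add0e 1?setIC//.
  apply: (subset_measure0 _ _ _ PC) => //; first exact: measurableD.
  exact: measurableC.
have tD : trivIset setT (fun n => G `&` D n).
  apply/trivIsetP => m n _ _; rewrite neq_ltn => /orP[] mn; apply/seteqP;
    split=> // w [[Gw Dm] [_ Dn]].
  - exact: (GD m n w).
  - exact: (GD n m w).
have sum n : (\sum_(0 <= i < n) P (G `&` D i) + M n = M 0%N)%E.
  elim: n => [|n IH]; first by rewrite big_geq// add0e.
  by rewrite big_nat_recr//= PG -addeA [(P _ + _)%E]addeC -step.
rewrite setI_bigcupr.
have : (\sum_(0 <= i < n) P (G `&` D i) + M n)%E @[n --> \oo] -->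
    (P (\bigcup_n (G `&` D n)) + 0)%E.
  apply: cvgeD => //.
    by rewrite fin_num_adde_defl.
  apply: measure_semi_sigma_additive => //.
    by move=> n; exact: measurableI.
  by apply: bigcup_measurable => n _; exact: measurableI.
rewrite adde0 (funext sum) => cvgM0.
by apply: (cvg_unique _ cvgM0) => //; exact: cvg_cst.
Qed.


Definition regular : set T :=
  [set w | forall n, 0 < X n w /\ 0 < Y n w].

Lemma regularE : regular =
  \bigcap_n (X n @^-1` `]0, +oo[%classic `&` Y n @^-1` `]0, +oo[%classic).
Proof.
apply/seteqP; split=> w Gw n.
  by move=> _; have [Xn Yn] := Gw n; split; rewrite /= in_itv/= ?Xn ?Yn.
by have [] := Gw n I; rewrite /= !in_itv/= !andbT.
Qed.

Let mpre (Z : {RV P >-> R}) (B : set R) : measurable B -> measurable (Z @^-1` B).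
Proof. by move=> mB; rewrite -[_ @^-1` _]setTI; exact: measurable_funP. Qed.

Lemma measurable_regular : measurable regular.
Proof.
rewrite regularE; apply: bigcapT_measurable => n.
by apply: measurableI; exact: mpre.
Qed.

Lemma ae_regular : {ae P, forall w, regular w}.
Proof.
apply/ae_foralln => n.
have X_gt0 : {ae P, forall w, 0 < X n w}.
  exists (X n @^-1` `]-oo, 0]%classic); split=> //.
  - exact: mpre.
  - by rewrite X_law//; exact: (exponential_le0 muX_exp).
  - by move=> w /=; rewrite in_itv/= => /negP; rewrite -leNgt.
by apply: filterS2 X_gt0 (Y_gt0 n) => w.
Qed.

Lemma probability_regular : P regular = 1%E.
Proof.
have mr := measurable_regular.
rewrite -[regular]setCK probability_setC; last exact: measurableC.
rewrite [X in (1 - X)%E](_ : _ = 0%E) ?sube0//.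
by apply: (measure_negligible (measurableC mr)); exact: ae_regular.
Qed.

Lemma ae_overtake : {ae P, forall w, ~ (forall n, alone (X ^~ w) (Y ^~ w) n)}.
Proof.
have ma n : measurable [set w | a n w].
  apply: measurable_bool; apply: past_measurable.
  exact: (@measurable_alone_past (history n) n (fun _ => id)).
exists (\bigcap_n [set w | a n w]); split.
- exact: bigcapT_measurable.
- apply/eqP; rewrite eq_le measure_ge0 andbT.
  have : P [set w | a n w] @[n --> \oo] --> 0%E.
    by apply: alone_vanishing => n; rewrite measure_ge0 lexx.
  move=> /cvg_lim <-//; apply: lime_ge => //.
  + apply/cvg_ex; exists 0%E. 
    by apply: alone_vanishing => n; rewrite measure_ge0 lexx.
  + apply: nearW => n; apply: le_measure; rewrite ?inE//.
      exact: bigcapT_measurable.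
    by move=> w; apply.
- by move=> w /= /contrapT An n _ /=; exact/asboolP.
Qed.

(** With [arrival_unbounded], this excludes that infinitely many customers
arrive in a bounded time. *)
Lemma ae_long_interarrival k :
  {ae P, forall w, exists n, (k <= n)%N /\ 1 < X n w}.
Proof.
pose B := `]-oo, (1 : R)]%classic.
have mB : measurable B by exact: measurable_itv.
pose c := 1 - expR (- lambda).
have XB n : P (X n @^-1` B) = c%:E.
  rewrite X_law// /B (@itv_bndbnd_setU _ _ _ (BLeft 0))//; last by rewrite bnd_simp.
  rewrite measureU//; last first.
    by apply/seteqP; split=> // z [] /=; rewrite !in_itv/= => z0 /andP[]; rewrite leNgt z0.
  rewrite [X in (X + _)%E](_ : _ = 0%E); last exact: (exponential_lt0 muX_exp).
  rewrite add0e.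
  have := exponential_itvcc muX_exp (@ler01 R); rewrite mulr1; exact.
pose C := \bigcap_j (X (k + j)%N @^-1` B).
have mC : measurable C by apply: bigcapT_measurable => j; exact: mpre.
have PC m : (P C <= (c ^+ m)%:E)%E.
  pose s := [seq inl (k + i)%N : nat + nat | i <- iota 0 m].
  have us : uniq s by rewrite map_inj_uniq ?iota_uniq// => i j [] /addnI.
  have -> : (c ^+ m)%:E = P (\bigcap_(i in [set` s]) (marks i @^-1` B)).
    rewrite (@indep s (fun=> B) us (fun=> mB)) big_map.
    under eq_bigr do rewrite XB.
    by rewrite prodEFin big_const_seq count_predT size_iota -Monoid.iteropE.
  apply: le_measure; rewrite ?inE//.
    apply: fin_bigcap_measurable; first exact: finite_seq.
    by move=> i _; exact: mpre.
  by move=> w Cw _ /= /mapP[i _ ->]; exact: Cw.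
exists C; split => //.
- apply/eqP; rewrite eq_le measure_ge0 andbT.
  apply: (@cvge_ge nat \oo _ R (fun m => (c ^+ m)%:E)).
    by apply: nearW => m; exact: PC.
  apply: cvg_EFin; first exact: nearW.
  apply: (@cvg_expr R c).
  have := expR_gt0 (- lambda); have : expR (- lambda) < 1.
    by rewrite -[ltRHS]expR0 ltr_expR oppr_lt0.
  by rewrite ltr_norml /c => ? ?; apply/andP; split; lra.
- move=> w /= noX j _; rewrite /preimage /B/= in_itv/= leNgt; apply/negP => X1.
  by apply: noX; exists (k + j)%N; rewrite leq_addr.
Qed.

Lemma arrival_unbounded (x : nat -> R) : (forall n, 0 < x n) ->
  (forall k, exists n, (k <= n)%N /\ 1 < x n) ->
  forall b, exists n, b < arrival x n.
Proof.
move=> x_gt0 x1 b.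
suff reach m : exists n, m%:R <= arrival x n.
  have [n nb] := reach (Num.bound `|b|); exists n.
  rewrite (le_lt_trans (ler_norm b))// (lt_le_trans _ nb)//.
  exact: archi_boundP.
elim: m => [|m [n mn]].
  by exists 0%N; rewrite /arrival big_ord1 ltW.
have [j [nj xj]] := x1 n.+1; case: j nj xj => // j nj xj.
exists j.+1; rewrite arrivalS -natr1 lerD// ?(ltW xj)//.
by rewrite (le_trans mn)// arrival_le.
Qed.

Lemma ae_cycle_ends : {ae P, forall w,
  [/\ regular w, forall b, exists n, b < arrival (X ^~ w) n &
      exists N, alone (X ^~ w) (Y ^~ w) N /\ X N.+1 w < Y N w]}.
Proof.
have long := ae_foralln ae_long_interarrival.
apply: filterS3 ae_regular ae_overtake long => w rw ow lw; split => //.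
  by apply: arrival_unbounded => // n; have [] := rw n.
exact: (@not_alone _ (X ^~ w) (Y ^~ w)).
Qed.

(** Sojourn times are only described on regular paths, whence the passage to
an almost everywhere equal measurable event. *)
Lemma has_probability_exit (D : nat -> T -> bool) (A : set T) (r : \bar R) :
  (forall n, measurable_fun [set: T] (D n)) ->
  (forall w, (forall n, 0 < X n w) -> (forall n, 0 < Y n w) ->
     (forall b, exists n, b < arrival (X ^~ w) n) ->
     forall N, alone (X ^~ w) (Y ^~ w) N -> X N.+1 w < Y N w ->
     A w <-> exists n, D n w) ->
  P (regular `&` \bigcup_n [set w | D n w]) = r ->
  has_probability P A r.
Proof.
move=> mD AD PD; exists (regular `&` \bigcup_n [set w | D n w]); split => //.
  apply: measurableI; first exact: measurable_regular.
  by apply: bigcup_measurable => n _; exact: measurable_bool.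
apply: filterS ae_cycle_ends => w [rw uw [N [aN oN]]].
have X0 n : 0 < X n w by have [] := rw n.
have Y0 n : 0 < Y n w by have [] := rw n.
rewrite (AD w X0 Y0 uw N aN oN); split=> [[n Dn]|[_ [n _ Dn]]]; last by exists n.
by split => //; exists n.
Qed.

Lemma has_probability_idle_gt t : 0 <= t ->
  has_probability P [set w | (t%:E < sojourn (X ^~ w) (Y ^~ w) 0)%E]
    ((1 - q) * expR (- (lambda * q * t)))%:E.
Proof.
move=> t0; apply: (@has_probability_exit (idle_exit t)).
- by move=> n; exact: measurable_idle_exit.
- move=> w X0 Y0 uw N aN oN /=.
  rewrite (sojourn_idle X0 Y0 uw aN oN) lte_fin (idle_crossing aN oN t0).
  split=> -[n].
    by move=> [an /andP[rn rn1]]; exists n; apply/and3P; split => //; exact/asboolP.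
  by move=> /and3P[/asboolP an rn rn1]; exists n; rewrite /rho in rn rn1; rewrite rn rn1.
have p0 : 0 <= 1 - q by rewrite subr_ge0.
pose M n := (\int[P]_w ((1 - q) * idle_mass t n w)%:E)%E.
rewrite (@exit_probability M).
- rewrite /M (eq_integral (cst ((1 - q) * expR (- (lambda * q * t)))%:E)).
    rewrite integral_cst// [X in (_ * X)%E](_ : _ = 1%E) ?mule1//.
    exact: probability_setT.
  by move=> w _; rewrite /idle_mass alone0 /rho /idle big_ord0 t0 subr0.
- by move=> n; exact: (measurable_bool (@measurable_idle_exit t n)).
- exact: measurable_regular.
- exact: probability_regular.
- move=> m n w mn _ /and3P[_ _ tm] /and3P[/asboolP an rn _].
  have /(idle_le an) : (m.+1 <= n <= n.+1)%N by rewrite mn leqnSn.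
  by rewrite leNgt (le_lt_trans rn tm).
- by move=> n; exact: idle_step.
- apply: alone_vanishing => n; apply/andP; split.
    by apply: integral_ge0 => w _; rewrite lee_fin mulr_ge0 ?idle_mass_ge0.
  have ma : measurable_fun [set: T] (a n).
    by apply: past_measurable; exact: (@measurable_alone_past (history n) n (fun _ => id)).
  rewrite probability_bool//; apply: ge0_le_integral => //.
  + by move=> w _; rewrite lee_fin mulr_ge0 ?idle_mass_ge0.
  + have mm := past_measurable (@measurable_idle_mass t n).
    by apply: (measurable_toE (f := fun w => (1 - q) * idle_mass t n w)); exact: measurable_funM.
  + by apply: (measurable_toE (f := fun w => if a n w then 1 else 0)); exact: measurable_fun_ifT.
  + move=> w _; rewrite lee_fin /idle_mass; case: (a n w) => /=; last by rewrite mulr0.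
    case: (leP (rho n w) t) => [rt|_]; last by rewrite mulr0.
    rewrite mulr_ile1 ?expR_ge0// ?lerBlDr ?lerDl//.
    by rewrite -[leRHS]expR0 ler_expR oppr_le0 !mulr_ge0 ?(ltW lambda_gt0)// subr_ge0.
Qed.

Lemma has_probability_alone_gt t : 0 <= t ->
  has_probability P [set w | (t%:E < sojourn (X ^~ w) (Y ^~ w) 1)%E]
    (expR (- (lambda * t)))%:E.
Proof.
move=> t0; apply: (@has_probability_exit (busy_exit t)).
- by move=> n; exact: measurable_busy_exit.
- move=> w X0 Y0 uw N aN oN /=.
  rewrite (sojourn_alone X0 Y0 uw aN oN) lte_fin (busy_crossing X0 Y0 aN oN t0).
  split=> -[n].
    by move=> [an /andP[sn sn1] sx]; exists n; apply/and4P; split => //; exact/asboolP.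
  by move=> /and4P[/asboolP an sn sn1 sx]; exists n; split => //; apply/andP.
pose M n := (\int[P]_w (busy_mass t n w)%:E)%E.
rewrite (@exit_probability M).
- rewrite /M (eq_integral (cst (expR (- (lambda * t)))%:E)).
    rewrite integral_cst// [X in (_ * X)%E](_ : _ = 1%E) ?mule1//.
    exact: probability_setT.
  by move=> w _; rewrite /busy_mass alone0 /sig /busy big_ord0 t0 subr0.
- by move=> n; exact: (measurable_bool (@measurable_busy_exit t n)).
- exact: measurable_regular.
- exact: probability_regular.
- move=> m n w mn rw /and4P[_ _ tm _] /and4P[_ sn _ _].
  have Y0 i : 0 < Y i w by have [] := rw i.
  have := busy_le Y0 mn.
  by rewrite leNgt (le_lt_trans sn tm).
- by move=> n; exact: busy_step.
- apply: alone_vanishing => n; apply/andP; split.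
    by apply: integral_ge0 => w _; rewrite lee_fin busy_mass_ge0.
  have ma : measurable_fun [set: T] (a n).
    by apply: past_measurable; exact: (@measurable_alone_past (history n) n (fun _ => id)).
  rewrite probability_bool//; apply: ge0_le_integral => //.
  + by move=> w _; rewrite lee_fin busy_mass_ge0.
  + exact: (measurable_toE (past_measurable (@measurable_busy_mass t n))).
  + by apply: (measurable_toE (f := fun w => if a n w then 1 else 0)); exact: measurable_fun_ifT.
  + move=> w _; rewrite lee_fin /busy_mass; case: (a n w) => //=.
    case: (leP (sig n w) t) => [st|_] //.
    by rewrite -[leRHS]expR0 ler_expR oppr_le0 mulr_ge0 ?(ltW lambda_gt0)// subr_ge0.
Qed.

End recursion.

Lemma has_probability_setC d (T : measurableType d) (R : realType)
    (P : probability T R) (A : set T) (p : \bar R) :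
  has_probability P A p -> has_probability P (~` A) (1 - p)%E.
Proof.
move=> [B [mB AB PB]]; exists (~` B); split; first exact: measurableC.
  by apply: filterS AB => w AB; split=> nA /AB.
by rewrite probability_setC// PB.
Qed.

(** * The laws of the sojourn times *)

Theorem mainTheorem8 (R : realType)
  (lambda : R) (lambda_gt0 : 0 < lambda)
  (G : R -> R) (G0 : G t @[t --> 0^'+] --> (0 : R))
  (* the queueing system: X n are the interarrival times, Y n the service times *)
  (d : measure_display) (Omega : measurableType d) (P : probability Omega R)
  (X Y : nat -> {RV P >-> R})
  (X_exp : forall n, exponentially_distributed lambda (X n))
  (Y_law : forall n t, P [set w | Y n w < t] = (G t)%:E)
  (XY_indep : mutually_independent P
     (fun i : nat + nat => match i with inl n => X n | inr n => Y n end))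
  (* the pair (tau, eta) defining q *)
  (d' : measure_display) (Omega' : measurableType d') (P' : probability Omega' R)
  (tau eta : {RV P' >-> R})
  (tau_exp : exponentially_distributed lambda tau)
  (eta_law : forall t, P' [set w | eta w < t] = (G t)%:E)
  (tau_eta_indep : mutually_independent P'
     (fun b : bool => if b then tau else eta))
  (q : R) (q_def : P' [set w | tau w < eta w] = q%:E) :
  let alpha k w := sojourn (X ^~ w) (Y ^~ w) k in
  [/\ forall t : R, 0 < t ->
        has_probability P [set w | (t%:E < alpha 0%N w)%E]
          ((1 - q) * expR (- (lambda * q * t)))%:E,
      has_probability P [set w | alpha 0%N w = 0%E] q%:E
    & forall t : R, 0 < t ->
        has_probability P [set w | (t%:E < alpha 1%N w)%E]
          (expR (- (lambda * t)))%:E].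
Proof.
have indep : mutually_independent P
    (fun i => marks X Y i : Omega -> R).
  congr (mutually_independent P _): XY_indep.
  by apply/funext => -[].
have eta_itv t : distribution P' eta `]-oo, t[%classic = (G t)%:E.
  by rewrite -eta_law; congr (P' _); apply/seteqP; split=> w /=; rewrite in_itv.
have Y_itv n t : distribution P (Y n) `]-oo, t[%classic = (G t)%:E.
  by rewrite -(Y_law n); congr (P _); apply/seteqP; split=> w /=; rewrite in_itv.
have eta_le0 := probability_le0 eta_itv G0.
(* the laws of [tau] and [eta] serve as common laws of all interarrival and
   service times, which makes [q] available for each customer *)
have X_tau n B : measurable B -> P (X n @^-1` B) = distribution P' tau B.
  by move=> mB; rewrite tau_exp// -(X_exp n).
have Y_eta n B : measurable B -> P (Y n @^-1` B) = distribution P' eta B.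
  move=> mB; apply: (@eq_probability_itvNyo _ (distribution P (Y n))) => // t.
  by transitivity (G t)%:E; [exact: Y_itv|exact/esym/eta_itv].
have q_ge0 := race_ge0 q_def.
have q_le1 := race_le1 q_def.
have q_gt0 := race_gt0 lambda_gt0 tau_exp tau_eta_indep q_def eta_law G0.
have laplace := laplace_race tau_exp tau_eta_indep eta_le0 q_def.
have idle_gt t (t0 : 0 <= t) := has_probability_idle_gt lambda_gt0 q_ge0 q_le1
  tau_exp eta_le0 laplace X_tau Y_eta indep q_gt0 t0.
split=> [t /ltW|| t /ltW t0].
- exact: idle_gt.
  (* at level 0 the tail is [1 - q], and a sojourn time is zero unless positive *)
- have := has_probability_setC (idle_gt 0 (lexx 0)).
  rewrite mulr0 oppr0 expR0 mulr1 -EFinB opprB addrC subrK.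
  congr (has_probability P _ _); apply/seteqP; split=> w /=.
    by move=> /negP; rewrite -leNgt => w0; apply/eqP; rewrite eq_le w0 measure_ge0.
  by move=> ->; rewrite ltxx.
- exact: (has_probability_alone_gt lambda_gt0 q_le1
    tau_exp eta_le0 laplace X_tau Y_eta indep q_gt0 t0).
Qed.
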